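(* Let $G=(V,E)$ be a directed feedback graph with $|V|\ge 2$, fixed and known to the player in advance. Let $\alpha=\alpha(G)$ be its independence number and $\delta=\delta(G)$ its weak domination number. Then, for $T\ge |V|^3$, the minimax regret $R(G,T)$ of the $T$-round online learning problem with feedback graph $G$ satisfies: (i) $R(G,T)=\tilde\Theta(\alpha^{1/2}T^{1/2})$ if $G$ is strongly observable; (ii) $R(G,T)=\tilde\Theta(\delta^{1/3}T^{2/3})$ if $G$ is weakly observable; (iii) $R(G,T)=\Theta(T)$ if $G$ is not observable.
   Context: Let $G=(V,E)$ be a directed graph (self-loops $(i,i)$ allowed) on the action set $V=\{1,\dots,K\}$. For $i\in V$ let $N^{\mathrm{in}}(i)=\{j\in V:(j,i)\in E\}$ and $N^{\mathrm{out}}(i)=\{j\in V:(i,j)\in E\}$. Online learning with feedback graph $G$: before the game the environment fixes loss functions $\ell_1,\ell_2,\dots$ with $\ell_t:V\to[0,1]$. On each round $t$ the player randomly chooses an action $I_t\in V$ (depending on past observations), incurs loss $\ell_t(I_t)$, and at the end of the round observes only $\{(j,\ell_t(j)):j\in N^{\mathrm{out}}(I_t)\}$ (in particular, it does not observe its own loss unless $I_t$ has a self-loop). The expected regret against $\ell_1,\dots,\ell_T$ is $\mathbb{E}[\sum_{t=1}^T\ell_t(I_t)]-\min_{i\in V}\sum_{t=1}^T\ell_t(i)$. The minimax regret $R(G,T)$ is the infimum over all randomized player strategies of the supremum over all loss sequences $\ell_1,\dots,\ell_T$ of the expected regret. A vertex $i$ is observable if $N^{\mathrm{in}}(i)\neq\emptyset$;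 strongly observable if $\{i\}\subseteq N^{\mathrm{in}}(i)$ or $V\setminus\{i\}\subseteq N^{\mathrm{in}}(i)$ (or both); weakly observable if observable but not strongly observable. $G$ is observable if all vertices are observable, strongly observable if all vertices are strongly observable, and weakly observable if it is observable but not strongly observable. If $W$ is the set of weakly observable vertices, a weakly dominating set is a set $D\subseteq V$ such that for every $w\in W$ there is $d\in D$ with $w\in N^{\mathrm{out}}(d)$; the weak domination number $\delta(G)$ is the size of a smallest weakly dominating set. An independent set is $S\subseteq V$ such that $(u,v)\notin E$ for all distinct $u,v\in S$; $\alpha(G)$ is the size of a largest independent set. $\tilde\Theta$ denotes equality up to constant factors and factors logarithmic in $K$ and $T$. *)

(* Defs.v *)
From HB Require Import structures.
From mathcomp Require Import all_boot all_order all_algebra.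
From mathcomp Require Import all_classical all_reals all_analysis.
Set Implicit Arguments. Unset Strict Implicit. Unset Printing Implicit Defensive.
Import Order.TTheory GRing.Theory Num.Theory.
Local Open Scope classical_set_scope.
Local Open Scope ring_scope.

(* Action set V = 'I_K; a directed feedback graph is a relation G : rel 'I_K,
   with (i,j) \in E  iff  G i j  (self-loops allowed). *)

Section Graph.
Variables (K : nat) (G : rel 'I_K).

Definition observable_vertex (i : 'I_K) : bool := [exists j, G j i].
Definition strongly_observable_vertex (i : 'I_K) : bool :=
  G i i || [forall j, (j != i) ==> G j i].
Definition weakly_observable_vertex (i : 'I_K) : bool :=
  observable_vertex i && ~~ strongly_observable_vertex i.

Definition observable : bool := [forall i, observable_vertex i].
Definition strongly_observable : bool := [forall i, strongly_observable_vertex i].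
Definition weakly_observable : bool := observable && ~~ strongly_observable.

Definition weakly_dominating (D : {set 'I_K}) : bool :=
  [forall w, weakly_observable_vertex w ==> [exists d in D, G d w]].

(* weak domination number: size of a smallest weakly dominating set
   (the full vertex set is always one when every vertex is observable) *)
Definition weak_domination_number : nat :=
  \big[minn/K]_(D : {set 'I_K} | weakly_dominating D) #|D|.

Definition independent (S : {set 'I_K}) : bool :=
  [forall u in S, forall v in S, (u != v) ==> ~~ G u v].

Definition independence_number : nat :=
  \max_(S : {set 'I_K} | independent S) #|S|.
End Graph.

Section Game.
Variables (R : realType) (K : nat) (G : rel 'I_K).

(* What the player sees at the end of a round: the action played and the
   losses of its out-neighbours (other entries are masked to 0; the player
   knows G and the action, so the mask carries no extra information). *)
Definition obs := ('I_K * ('I_K -> R))%type.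

Definition strategy := seq obs -> 'I_K -> R.

Definition valid_strategy (p : strategy) : Prop :=
  forall h, (forall i, 0 <= p h i) /\ \sum_i p h i = 1.

Definition admissible_losses (l : nat -> 'I_K -> R) : Prop :=
  forall t i, 0 <= l t i <= 1.

Definition feedback (l : nat -> 'I_K -> R) (t : nat) (i : 'I_K) : obs :=
  (i, fun j => if G i j then l t j else 0).

Fixpoint exp_loss (p : strategy) (l : nat -> 'I_K -> R) (h : seq obs)
    (t n : nat) : R :=
  match n with
  | 0 => 0
  | n'.+1 => \sum_i p h i *
      (l t i + exp_loss p l (rcons h (feedback l t i)) t.+1 n')
  end.

Definition cum_loss (l : nat -> 'I_K -> R) (T : nat) (i : 'I_K) : R :=
  \sum_(t < T) l t i.

(* min over actions of the cumulative loss; the seed T%:R is an upper bound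
   for admissible losses, so this is the exact minimum when K >= 1. *)
Definition best_loss (l : nat -> 'I_K -> R) (T : nat) : R :=
  \big[Order.min/T%:R]_i cum_loss l T i.

Definition regret (p : strategy) (l : nat -> 'I_K -> R) (T : nat) : R :=
  exp_loss p l [::] 0 T - best_loss l T.

Definition worst_regret (p : strategy) (T : nat) : R :=
  sup [set r | exists l, admissible_losses l /\ r = regret p l T].

Definition minimax_regret (T : nat) : R :=
  inf [set r | exists p, valid_strategy p /\ r = worst_regret p T].
End Game.

(* Main.v *)
(* Upper bounds: exponential weights on importance-weighted loss estimates, with
   the potential [L k + ln (\sum_j exp (- eta L j)) / eta].  One round increases
   it in expectation by the regret plus [eta] times the second moment of the
   estimates.  For weakly observable graphs one explores a weakly dominating set
   and two more vertices, so that every vertex without a self-loop is observed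
   with probability of order [gamma / delta].  For strongly observable graphs the
   second moment over the vertices with a self-loop is at most
   [2 alpha (1 + ln (1 / min p))] by a weighted Caro-Wei argument, and the at
   most one rarely observed loopless vertex is handled by subtracting its
   estimate from all the others.

   Lower bounds: a safe action loses [1/2 - eps], the actions of a set [U] lose
   fair bits, every other action loses [1].  Tilting the bit of one [k] in [U] to
   mean [1/2 - 2 eps] makes [k] optimal, and this is detected only by playing the
   in-neighbours of [k]; summing over [k] shows that some tilt goes unnoticed
   unless exploration alone already costs [eps T / 4].  [U] is an independent set
   minus a vertex in the strongly observable case.  In the weakly observable case
   it is an independent set of weakly observable vertices such that every vertex
   dominates only O(ln K) of them: failure of the greedy cover to find a
   dominating set smaller than [delta] gives a set in which every vertex
   dominates a fraction O(ln K / delta), from which [U] is sampled. *)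
Require Import Defs.
From HB Require Import structures.
From mathcomp Require Import all_boot all_order all_algebra.
From mathcomp Require Import all_classical all_reals all_analysis.
(* [fintype] and [finset] come last: [classical_sets] shadows their names. *)
From mathcomp Require Import ring lra fintype finset.
Set Implicit Arguments. Unset Strict Implicit. Unset Printing Implicit Defensive.
Import Order.TTheory GRing.Theory Num.Theory.
Local Open Scope ring_scope.

(** * Weighted independence bounds *)

(** Since [1 - x / 2 <= expR (- (x / 2))], it is enough that [(1 + x + x ^+ 2) * (1 - x / 2) ^+ 2]
    is at least [1]; the excess is [x ^+ 2 / 4] times a quadratic that stays positive up to
    [1 / 3]. *)
Lemma expR_le_quad (R : realType) (x : R) :
  x <= 3^-1 -> expR x <= 1 + x + x ^+ 2.
Proof.
move=> x3.
have h : 1 - x / 2 <= expR (- (x / 2)) by exact: expR_ge1Dx.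
have h0 : 0 <= 1 - x / 2 by lra.
have h2 : (1 - x / 2) ^+ 2 <= expR (- (x / 2)) ^+ 2 by rewrite lerXn2r // nnegrE expR_ge0.
have h3 : expR x * (1 - x / 2) ^+ 2 <= 1.
  apply: (@le_trans _ _ (expR x * expR (- (x / 2)) ^+ 2)).
    by rewrite ler_wpM2l ?expR_ge0.
  rewrite expr2 mulrA -!expRD (_ : x + _ + _ = 0) ?expR0 //.
  by field.
have pos : 0 < (1 - x / 2) ^+ 2 by rewrite exprn_gt0 //; lra.
rewrite -(ler_pM2r pos) (le_trans h3) //.
have -> : (1 + x + x ^+ 2) * (1 - x / 2) ^+ 2 =
  1 + x ^+ 2 / 4 * ((x - 3 / 2) ^+ 2 - 5 / 4) by field.
rewrite lerDl mulr_ge0 ?divr_ge0 ?sqr_ge0 // subr_ge0.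
rewrite (_ : 5 / 4 <= _) //; nra.
Qed.

(** Each [expR (y i)] lies above the tangent line of [expR] at the mean [m]. *)
Lemma expR_jensen (R : realType) (I : finType) (w y : I -> R) :
  (forall i, 0 <= w i) -> \sum_i w i = 1 ->
  expR (\sum_i w i * y i) <= \sum_i w i * expR (y i).
Proof.
move=> w0 w1; set m := \sum_i w i * y i.
have -> : expR m = \sum_i w i * (expR m * (1 + (y i - m))).
  rewrite (eq_bigr (fun i => expR m * (w i * (1 - m) + w i * y i))); last first.
    by move=> i _; ring.
  by rewrite -big_distrr big_split /= -big_distrl /= w1 -/m; ring.
apply: ler_sum => i _; apply: ler_wpM2l => //.
have -> : expR (y i) = expR m * expR (y i - m) by rewrite -expRD; congr expR; ring.
by rewrite ler_wpM2l ?expR_ge0 // expR_ge1Dx.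
Qed.

Lemma ln_ge1BV (R : realType) (x : R) : 0 < x -> 1 - x^-1 <= ln x.
Proof.
move=> x0; have := @le_ln1Dx R (x^-1 - 1).
rewrite (_ : 1 + (x^-1 - 1) = x^-1); last by ring.
rewrite lnV ?posrE // => H.
have : -1 < x^-1 - 1 by have := invr_gt0 x; rewrite x0; lra.
move=> /H; lra.
Qed.

Section GraphLemmas.
Variables (R : realType) (K : nat) (G : rel 'I_K).
Implicit Types (A S : {set 'I_K}) (p : 'I_K -> R).

(** Closed neighbourhoods within [A]: [nbr_weight] forgets orientation, as independence does, while
    [in_weight] counts [j] and the actions that reveal it. *)
Definition nbr_weight p A j : R := \sum_(i in A | [|| i == j, G i j | G j i]) p i.
Definition in_weight p A j : R := \sum_(i in A | (i == j) || G i j) p i.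

Lemma independent0 : independent G set0.
Proof. by apply/forall_inP => u; rewrite inE. Qed.

Lemma nbr_weight_ge p A j : (forall i, i \in A -> 0 < p i) -> j \in A ->
  p j <= nbr_weight p A j.
Proof.
move=> p0 jA; rewrite /nbr_weight (bigD1 j) /= ?jA ?eqxx //= lerDl.
by apply: sumr_ge0 => i /andP[/andP[iA _] _]; exact/ltW/p0.
Qed.

Lemma in_weight_ge p A j : (forall i, i \in A -> 0 < p i) -> j \in A ->
  p j <= in_weight p A j.
Proof.
move=> p0 jA; rewrite /in_weight (bigD1 j) /= ?jA ?eqxx //= lerDl.
by apply: sumr_ge0 => i /andP[/andP[iA _] _]; exact/ltW/p0.
Qed.

(* Weighted Caro-Wei bound: repeatedly pick the vertex of smallest closed
   neighbourhood weight and delete its neighbourhood. *)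
Lemma caro_wei p A : (forall i, i \in A -> 0 < p i) ->
  exists S, [/\ S \subset A, independent G S &
    \sum_(j in A) p j / nbr_weight p A j <= #|S|%:R].
Proof.
have [n] := ubnP #|A|; elim: n => // n IH in A *; rewrite ltnS => cA p0.
have [->|[j0 j0A]] := set_0Vmem A.
  by exists set0; rewrite independent0 sub0set big_set0 cards0.
case: (@Order.TotalTheory.arg_minP _ _ _ j0 (mem A) (nbr_weight p A) j0A) => j jA jmin.
have {}jA : j \in A := jA.
pose C := [set i in A | [|| i == j, G i j | G j i]].
have CA : C \subset A by apply/subsetP => i; rewrite inE => /andP[].
have jC : j \in C by rewrite inE jA eqxx.
have Njpos : 0 < nbr_weight p A j by exact: lt_le_trans (p0 _ jA) (nbr_weight_ge p0 jA).
have [||S [SA Sind HS]] := IH (A :\: C).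
- apply: leq_trans cA; apply: proper_card; apply/properP; split; first exact: subsetDl.
  by exists j => //; rewrite inE jC.
- by move=> i; rewrite inE => /andP[_]; exact: p0.
have jS : j \notin S by apply/negP => /(subsetP SA); rewrite inE jC.
have nS v : v \in S -> [/\ v != j, ~~ G v j & ~~ G j v].
  move=> /(subsetP SA); rewrite !inE => /andP[+ vA]; rewrite vA /=.
  by rewrite !negb_or => /and3P[].
exists (j |: S); split.
- by rewrite subUset sub1set jA (subset_trans SA) // subsetDl.
- apply/forall_inP => u /setU1P uS; apply/forall_inP => v /setU1P vS.
  apply/implyP => uv; case: uS vS => [eu|uS] [ev|vS].
  + by rewrite eu ev eqxx in uv.
  + by rewrite eu; case: (nS _ vS).
  + by rewrite ev; case: (nS _ uS).
  + by move/forall_inP : Sind => /(_ _ uS)/forall_inP/(_ _ vS)/implyP; apply.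
rewrite cardsU1 jS natrD (big_setID C) /= (setIidPr CA); apply: lerD.
  have -> : 1%:R = \sum_(i in C) p i / nbr_weight p A j.
    rewrite -big_distrl /= (_ : \sum_(i in C) p i = nbr_weight p A j).
      by rewrite mulfV // gt_eqF.
    by apply: eq_bigl => i; rewrite inE.
  apply: ler_sum => i iC; have iA := subsetP CA _ iC.
  rewrite ler_pM2l ?p0 // lef_pV2 ?posrE ?(lt_le_trans _ (jmin i iA)) //.
  exact: jmin.
apply: le_trans HS; apply: ler_sum => i /[dup] iAC; rewrite inE => /andP[iC iA].
have p0' k : k \in A :\: C -> 0 < p k by rewrite inE => /andP[_]; exact: p0.
have N'0 : 0 < nbr_weight p (A :\: C) i.
  exact: lt_le_trans (p0 _ iA) (nbr_weight_ge p0' iAC).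
have le : nbr_weight p (A :\: C) i <= nbr_weight p A i.
  rewrite /nbr_weight !big_mkcondr /= [leRHS](big_setID C) /= (setIidPr CA) lerDr.
  apply: sumr_ge0 => k kC; case: ifP => // _; apply/ltW/p0; exact: (subsetP CA).
by rewrite ler_pM2l ?p0 // lef_pV2 ?posrE // (lt_le_trans N'0).
Qed.

Lemma independent_card_le S : independent G S -> (#|S| <= independence_number G)%N.
Proof. by move=> Si; exact: (@leq_bigmax_cond _ (independent G) (fun S => #|S|)). Qed.

Lemma independence_number_gt0 : (0 < K)%N -> (0 < independence_number G)%N.
Proof.
move=> K0; rewrite -(cards1 (Ordinal K0)); apply: independent_card_le.
apply/forall_inP => u /set1P ->; apply/forall_inP => v /set1P ->.
by rewrite eqxx.
Qed.

(** Termwise this is [(1 - N i / t) ^+ 2 >= 0]. Being linear in [N], the bound turns a Caro-Wei sum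
    into a statement on the average neighbourhood weight. *)
Lemma sum_inv_ge (I : finType) (A : {set I}) (p N : I -> R) (t : R) :
  0 < t -> (forall i, i \in A -> 0 < p i /\ 0 < N i) ->
  2 * (\sum_(i in A) p i) / t - (\sum_(i in A) p i * N i) / t ^+ 2
    <= \sum_(i in A) p i / N i.
Proof.
move=> t0 pN; rewrite mulrAC mulrC mulrA !mulr_suml -sumrB.
apply: ler_sum => i /pN[p0 N0].
rewrite -subr_ge0 (_ : _ - _ = p i / N i * (1 - N i / t) ^+ 2).
  by rewrite mulr_ge0 ?sqr_ge0 // divr_ge0 // ltW.
by field; rewrite !gt_eqF.
Qed.


Hypothesis K_gt0 : (0 < K)%N.
Let alpha : R := (independence_number G)%:R.

Let alpha_ge1 : 1 <= alpha.
Proof. by rewrite ler1n independence_number_gt0. Qed.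

(** Caro-Wei with [t = P / alpha] in [sum_inv_ge] makes the [p]-weighted total of [nbr_weight] at
    least [P ^+ 2 / alpha]. In-weights carry at least half of it, and their maximum dominates their
    average. *)
Lemma heavy_in_weight p A : (forall i, i \in A -> 0 < p i) -> A != set0 ->
  exists2 j, j \in A & \sum_(i in A) p i <= 2 * alpha * in_weight p A j.
Proof.
move=> p0 An0; set P := \sum_(i in A) p i.
have /set0Pn[i0 i0A] := An0.
case: (@Order.TotalTheory.arg_maxP _ _ _ i0 (mem A) (in_weight p A) i0A) => j jA jmax.
have {}jmax k : k \in A -> in_weight p A k <= in_weight p A j := @jmax k.
have {}jA : j \in A := jA.
exists j => //; set M := in_weight p A j.
have P0 : 0 < P.
  rewrite /P (bigD1 i0) //=; apply: ltr_pwDl; first exact: p0.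
  by apply: sumr_ge0 => k /andP[kA _]; exact/ltW/p0.
have a0 : 0 < alpha by exact: lt_le_trans alpha_ge1.
have [S [_ Sind HS]] := caro_wei p0.
have Sa : #|S|%:R <= alpha by rewrite ler_nat independent_card_le.
have := sum_inv_ge (divr_gt0 P0 a0)
  (fun i iA => conj (p0 i iA) (lt_le_trans (p0 i iA) (nbr_weight_ge p0 iA))).
move=> /le_trans/(_ HS)/le_trans/(_ Sa); rewrite -/P.
(* An unoriented neighbourhood is covered by the in- and the out-neighbourhood, and exchanging the
   sums shows that both have the same weighted total. *)
have split_nbr : \sum_(j in A) p j * nbr_weight p A j <= 2 * \sum_(j in A) p j * in_weight p A j.
  have le k : k \in A -> nbr_weight p A k <= in_weight p A k +
      \sum_(i in A | (i == k) || G k i) p i.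
    move=> kA; rewrite /nbr_weight /in_weight !big_mkcondr -big_split /=.
    apply: ler_sum => i iA; have := p0 i iA.
    by case: (i == k); case: (G i k); case: (G k i) => /=; lra.
  apply: (@le_trans _ _ (\sum_(k in A) p k * (in_weight p A k +
      \sum_(i in A | (i == k) || G k i) p i))).
    by apply: ler_sum => k kA; rewrite ler_wpM2l ?le // ltW ?p0.
  under eq_bigr do rewrite mulrDr.
  rewrite big_split /= mulrDl !mul1r lerD2l.
  under eq_bigr do rewrite big_mkcondr mulr_sumr /=.
  rewrite exchange_big /=; apply: ler_sum => i iA.
  rewrite /in_weight big_mkcondr big_distrr /=; apply: ler_sum => k kA.
  by rewrite eq_sym; case: ifP; rewrite ?mulr0 // mulrC.
have : \sum_(k in A) p k * in_weight p A k <= P * M.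
  rewrite {1}/P big_distrl /=; apply: ler_sum => k kA.
  by rewrite ler_wpM2l ?jmax // ltW ?p0.
move: split_nbr; set X := \sum_(k in A) p k * nbr_weight p A k.
set Y := \sum_(k in A) _ => XY YM H.
have {}H : 2 * alpha - X * (alpha / P) ^+ 2 <= alpha.
  by apply: le_trans H; rewrite le_eqVlt; apply/orP; left; apply/eqP; field; rewrite !gt_eqF.
have XPM : X <= 2 * (P * M) by lra.
have sq0 : 0 <= (alpha / P) ^+ 2 by exact: sqr_ge0.
have : alpha <= 2 * (P * M) * (alpha / P) ^+ 2.
  by apply: (@le_trans _ _ (X * (alpha / P) ^+ 2)); [lra|rewrite ler_wpM2r].
rewrite (_ : _ * _ ^+ 2 = alpha * (2 * alpha * M / P)); last by field; rewrite gt_eqF.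
by rewrite -{1}[alpha]mulr1 ler_pM2l // ler_pdivlMr // mul1r.
Qed.

(* Deleting the vertex [j] of largest closed in-weight costs at most
   [2 alpha p j / p(A) <= 2 alpha ln (p(A) / p(A :\ j))], which telescopes. *)
Lemma in_weight_sum_ln p A eps : 0 < eps -> (forall i, i \in A -> eps <= p i) ->
  A != set0 ->
  \sum_(j in A) p j / in_weight p A j <=
    2 * alpha * (1 + ln ((\sum_(i in A) p i) / eps)).
Proof.
move=> e0; have a0 : 0 < alpha by exact: lt_le_trans alpha_ge1.
have [n] := ubnP #|A|; elim: n => // n IH in A *; rewrite ltnS => cA pe An0.
have p0 i : i \in A -> 0 < p i by move=> /pe; exact: lt_le_trans.
have [j jA Hj] := heavy_in_weight p0 An0.
have In0 i : i \in A -> 0 < in_weight p A i.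
  by move=> iA; exact: lt_le_trans (p0 _ iA) (in_weight_ge p0 iA).
set P := \sum_(i in A) p i in Hj *.
have defP : P = p j + \sum_(i in A :\ j) p i.
  rewrite /P (bigD1 j) //=; congr (_ + _); apply: eq_bigl => i.
  by rewrite !inE andbC.
have [A0|An0'] := eqVneq (A :\ j) set0.
  have defA : A = [set j].
    by apply/eqP; rewrite eqEsubset sub1set jA andbT -setD_eq0 A0.
  rewrite defP A0 big_set0 addr0 {1}defA big_set1.
  apply: (@le_trans _ _ (2 * 1)).
    rewrite ler_pdivrMr ?In0 //; have := in_weight_ge p0 jA; have := p0 _ jA; lra.
  have l0 : 0 <= ln (p j / eps) by rewrite ln_ge0 // ler_pdivlMr // mul1r pe.
  rewrite -mulrA ler_pM2l // -[leLHS]mulr1 ler_pM ?ler01 //; lra.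
have pe' i : i \in A :\ j -> eps <= p i by rewrite inE => /andP[_]; exact: pe.
have p0' i : i \in A :\ j -> 0 < p i by move=> /pe'; exact: lt_le_trans.
have {IH} := IH (A :\ j); rewrite (cardsD1 j A) jA add1n in cA.
move=> /(_ cA pe' An0'); set P' := \sum_(i in A :\ j) p i in defP *.
move=> H.
have P'0 : 0 < P'.
  have /set0Pn[i iA'] := An0'; rewrite /P' (bigD1 i) //=.
  apply: ltr_pwDl; first exact: p0'.
  by apply: sumr_ge0 => k /andP[kA _]; exact/ltW/p0'.
have P0 : 0 < P by rewrite defP addr_gt0 ?p0.
have -> : \sum_(k in A) p k / in_weight p A k = p j / in_weight p A j +
    \sum_(k in A :\ j) p k / in_weight p A k.
  by rewrite (bigD1 j) //=; congr (_ + _); apply: eq_bigl => i; rewrite !inE andbC.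
have Hmono : \sum_(k in A :\ j) p k / in_weight p A k <=
    \sum_(k in A :\ j) p k / in_weight p (A :\ j) k.
  apply: ler_sum => k kA'; have kA : k \in A by move: kA'; rewrite inE => /andP[].
  have N'0 : 0 < in_weight p (A :\ j) k.
    exact: lt_le_trans (p0' _ kA') (in_weight_ge p0' kA').
  rewrite ler_pM2l ?p0 // lef_pV2 ?posrE ?In0 //.
  rewrite /in_weight !big_mkcondr /= [leRHS](bigD1 j) //=.
  rewrite [X in _ <= _ + X](eq_bigl (mem (A :\ j))); last by move=> i; rewrite !inE andbC.
  by rewrite lerDr; case: ifP => // _; exact/ltW/p0.
have Hjt : p j / in_weight p A j <= 2 * alpha * ln (P / P').
  apply: (@le_trans _ _ (2 * alpha * (p j / P))).
    rewrite ler_pdivrMr ?In0 //.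
    rewrite [leRHS](_ : _ = p j * (2 * alpha * in_weight p A j / P)); last first.
      by field; rewrite gt_eqF.
    by rewrite ler_pMr ?p0 // ler_pdivlMr // mul1r.
  rewrite ler_pM2l ?mulr_gt0 //; have := ln_ge1BV (divr_gt0 P0 P'0).
  apply: le_trans; rewrite invf_div defP le_eqVlt; apply/orP; left; apply/eqP.
  by field; rewrite -defP gt_eqF.
have -> : ln (P / eps) = ln (P / P') + ln (P' / eps).
  rewrite -lnM ?posrE ?divr_gt0 //; congr ln; field.
  by rewrite !gt_eqF.
apply: (le_trans (lerD Hjt (le_trans Hmono H))).
by rewrite le_eqVlt; apply/orP; left; apply/eqP; ring.
Qed.

Lemma in_weight_sum p A eps : 0 < eps -> eps <= 1 ->
  (forall i, i \in A -> eps <= p i) -> \sum_(i in A) p i <= 1 ->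
  \sum_(j in A) p j / in_weight p A j <= 2 * alpha * (1 + ln (eps^-1)).
Proof.
move=> e0 e1 pe P1; have a0 : 0 < alpha by exact: lt_le_trans alpha_ge1.
have [->|An0] := eqVneq A set0.
  by rewrite big_set0 !mulr_ge0 ?addr_ge0 ?ln_ge0 ?invf_ge1 // ltW.
apply: (le_trans (in_weight_sum_ln e0 pe An0)).
rewrite ler_pM2l ?mulr_gt0 // lerD2l ler_ln ?posrE ?invr_gt0 //.
  by rewrite ler_pdivrMr // mulVf ?gt_eqF.
have /set0Pn[i iA] := An0; rewrite divr_gt0 // (bigD1 i) //=; apply: ltr_pwDl.
  exact: lt_le_trans (pe _ iA).
by apply: sumr_ge0 => k /andP[kA _]; exact/ltW/(lt_le_trans e0)/pe.
Qed.
End GraphLemmas.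

(** * Exponential weights *)

Section Game.
Variables (R : realType) (K : nat) (G : rel 'I_K).
Implicit Types (p : strategy R K) (l : nat -> 'I_K -> R).

Lemma exp_loss_ge0 p l h t n : valid_strategy p -> admissible_losses l ->
  0 <= exp_loss G p l h t n.
Proof.
move=> vp al; elim: n h t => //= n IH h t; apply: sumr_ge0 => i _.
by rewrite mulr_ge0 ?(vp h).1 // addr_ge0 //; case/andP: (al t i).
Qed.

Lemma exp_loss_le p l h t n : valid_strategy p -> admissible_losses l ->
  exp_loss G p l h t n <= n%:R.
Proof.
move=> vp al; elim: n h t => //= n IH h t.
rewrite -[n.+1%:R]mul1r -[X in X * _](vp h).2 mulr_suml; apply: ler_sum => i _.
rewrite ler_wpM2l ?(vp h).1 // -natr1 addrC lerD //.
by case/andP: (al t i).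
Qed.

Lemma cum_loss_ge0 l T i : admissible_losses l -> 0 <= cum_loss l T i.
Proof. by move=> al; apply: sumr_ge0 => t _; case/andP: (al t i). Qed.

Lemma cum_loss_le l T i : admissible_losses l -> cum_loss l T i <= T%:R.
Proof.
move=> al; rewrite -[T in leRHS]card_ord -sumr_const; apply: ler_sum => t _.
by case/andP: (al t i).
Qed.

Lemma best_loss_le l T i : best_loss l T <= cum_loss l T i.
Proof. by rewrite /best_loss; apply: bigmin_le. Qed.

Lemma best_loss_ge l T x : x <= T%:R -> (forall i, x <= cum_loss l T i) ->
  x <= best_loss l T.
Proof. by move=> xT xc; apply/bigmin_geP. Qed.

Lemma regret_le p l T : valid_strategy p -> admissible_losses l ->
  regret G p l T <= T%:R.
Proof.
move=> vp al; rewrite /regret lerBlDr (le_trans (exp_loss_le _ _ _ vp al)) //.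
by rewrite lerDl best_loss_ge // => i; exact: cum_loss_ge0.
Qed.

Lemma regret_le_worst p l T : valid_strategy p -> admissible_losses l ->
  regret G p l T <= worst_regret G p T.
Proof.
move=> vp al; apply: ub_le_sup; last by exists l.
by exists T%:R => _ [l' [al' ->]]; exact: regret_le.
Qed.

Lemma admissible0 : admissible_losses (fun (_ : nat) (_ : 'I_K) => 0 : R).
Proof. by move=> t i; rewrite lexx ler01. Qed.

(** A crude bound, from the zero losses; it makes the set under the infimum in [minimax_regret]
    bounded below. *)
Lemma worst_regret_ge p T : valid_strategy p -> - T%:R <= worst_regret G p T.
Proof.
move=> vp; apply: le_trans (regret_le_worst _ vp admissible0).
rewrite /regret; have := exp_loss_ge0 [::] 0 T vp admissible0.
suff : best_loss (fun (_ : nat) (_ : 'I_K) => 0 : R) T <= T%:R by lra.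
by rewrite /best_loss; apply: bigmin_le_id.
Qed.

Lemma minimax_regret_le (p : strategy R K) T (B : R) : (0 < K)%N -> valid_strategy p ->
  (forall l k, admissible_losses l ->
     exp_loss G p l [::] 0 T <= cum_loss l T k + B) ->
  minimax_regret R G T <= B.
Proof.
move=> K0 vp H; apply: (@le_trans _ _ (worst_regret G p T)).
  apply: ge_inf; last by exists p.
  by exists (- T%:R) => _ [p' [vp' ->]]; exact: worst_regret_ge.
apply: ge_sup; first by exists (regret G p (fun _ _ => 0) T), (fun _ _ => 0); split; [exact: admissible0|].
move=> _ [l [al ->]]; rewrite /regret lerBlDr -lerBlDl best_loss_ge //.
  (* The seed [T] of the minimum in [best_loss] has to be cleared too; the cumulative loss of any
     one action is at most [T]. *)
  by have := H l (Ordinal K0) al; have := cum_loss_le T (Ordinal K0) al; lra.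
by move=> i; have := H l i al; lra.
Qed.

Lemma minimax_regret_ge T (B : R) : (0 < K)%N ->
  (forall p, valid_strategy p -> exists2 l, admissible_losses l &
     exists k, cum_loss l T k + B <= exp_loss G p l [::] 0 T) ->
  B <= minimax_regret R G T.
Proof.
move=> K0 H; apply: lb_le_inf.
  (* The infimum must range over a nonempty set: always playing one fixed action is a valid
     strategy. *)
  exists (worst_regret G (fun _ i => (i == Ordinal K0)%:R) T), (fun _ i => (i == Ordinal K0)%:R).
  split=> // h; split=> [i|]; first exact: ler0n.
  by rewrite (bigD1 (Ordinal K0)) //= big1 ?addr0 => [|i /negPf -> //].
move=> _ [p [vp ->]]; have [l al [k Hk]] := H p vp.
apply: le_trans (regret_le_worst _ vp al); rewrite /regret.
by have := best_loss_le l T k; lra.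
Qed.

(** Amortised analysis: the one-round inequality telescopes along the histories, and [Phi >= 0]
    discards the final potential. *)
Lemma exp_loss_potential p l k (B : R) (Phi : seq (obs R K) -> R) :
  valid_strategy p -> (forall h, 0 <= Phi h) ->
  (forall h t, \sum_i p h i * (l t i + Phi (rcons h (feedback G l t i)))
     <= l t k + Phi h + B) ->
  forall n h t, exp_loss G p l h t n <=
    \sum_(s < n) l (t + s)%N k + Phi h + n%:R * B.
Proof.
move=> vp Phi0 step; elim=> [|n IH] h t /=.
  by rewrite big_ord0 mul0r add0r addr0.
rewrite big_ord_recl addn0.
under [in leRHS]eq_bigr do rewrite /bump /= addnA addn1.
set S := \sum_(i < n) _.
apply: (@le_trans _ _ (\sum_i p h i * (l t i + Phi (rcons h (feedback G l t i))) +
    (S + n%:R * B))).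
  rewrite -[X in _ + X]mul1r -[X in X * (S + _)](vp h).2 mulr_suml -big_split /=.
  apply: ler_sum => i _; rewrite -mulrDr ler_wpM2l ?(vp h).1 //.
  by have := IH (rcons h (feedback G l t i)) t.+1; rewrite -/S; lra.
have := step h t; rewrite -natr1 mulrDl mul1r; lra.
Qed.
End Game.

(** * Exponential weights with exploration on importance-weighted estimates *)

Section ExponentialWeights.
Variables (R : realType) (K : nat) (G : rel 'I_K).
Hypothesis K_gt0 : (0 < K)%N.
Variables (eta gamma : R) (u : 'I_K -> R).
Hypotheses (eta_gt0 : 0 < eta) (gamma_gt0 : 0 < gamma) (gamma_le : gamma <= 2^-1).
Hypotheses (u_ge0 : forall i, 0 <= u i) (u_sum : \sum_i u i = 1).
Implicit Types (L y lv : 'I_K -> R).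

Definition ew_total L := \sum_j expR (- (eta * L j)).
Definition ew_dist L j := expR (- (eta * L j)) / ew_total L.
Definition ew_mix L i := (1 - gamma) * ew_dist L i + gamma * u i.
Definition obs_prob (x : 'I_K -> R) j := \sum_(i | G i j) x i.
(** Masked entries of [o] are [0], so unobserved losses are estimated by [0]; the divisor is the
    observation probability under the distribution that was played. *)
Definition ew_update L (o : obs R K) j := L j + o.2 j / obs_prob (ew_mix L) j.
Definition ew_strategy : strategy R K := fun h => ew_mix (foldl ew_update (fun=> 0) h).
Definition ew_potential k L := L k + ln (ew_total L) / eta.
Definition loss_estimate L lv i j :=
  (if G i j then lv j else 0) / obs_prob (ew_mix L) j.

Lemma ew_total_gt0 L : 0 < ew_total L.
Proof.
rewrite /ew_total (bigD1 (Ordinal K_gt0)) //= ltr_pwDl ?expR_gt0 //.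
by apply: sumr_ge0 => i _; exact: expR_ge0.
Qed.

Lemma ew_dist_gt0 L j : 0 < ew_dist L j.
Proof. by rewrite divr_gt0 ?expR_gt0 ?ew_total_gt0. Qed.

Lemma ew_dist_sum L : \sum_j ew_dist L j = 1.
Proof. by rewrite -mulr_suml mulfV // gt_eqF // ew_total_gt0. Qed.

Lemma ew_mix_gt0 L i : 0 < ew_mix L i.
Proof.
have g1 : 0 < 1 - gamma by have := gamma_le; lra.
by apply: ltr_pwDl; [rewrite mulr_gt0 ?ew_dist_gt0|rewrite mulr_ge0 ?u_ge0 // ltW].
Qed.

Lemma ew_mix_sum L : \sum_i ew_mix L i = 1.
Proof. by rewrite big_split /= -!mulr_sumr ew_dist_sum u_sum; ring. Qed.

Lemma ew_dist_le_mix L j : ew_dist L j <= 2 * ew_mix L j.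
Proof.
have := ew_dist_gt0 L j; rewrite /ew_mix.
have := mulr_ge0 (ltW gamma_gt0) (u_ge0 j); have := gamma_le; nra.
Qed.

Lemma ew_valid : valid_strategy ew_strategy.
Proof. by move=> h; split=> [i|]; [exact/ltW/ew_mix_gt0|exact: ew_mix_sum]. Qed.

(** [ew_total L] contains the summand of [k], so the soft minimum of [L] is at most [L k]. *)
Lemma ew_potential_ge0 k L : 0 <= ew_potential k L.
Proof.
rewrite /ew_potential -(pmulr_rge0 _ eta_gt0) mulrDr mulrCA mulfV ?gt_eqF // mulr1.
rewrite -[eta * L k]opprK -[X in - X + _]expRK addrC subr_ge0 ler_ln ?posrE ?expR_gt0 ?ew_total_gt0 //.
rewrite /ew_total (bigD1 k) //= lerDl.
by apply: sumr_ge0 => i _; exact: expR_ge0.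
Qed.

(** Exponential weights do not change when all estimates move by a common [c], so the second moment
    may be centred at [c]. With [y j >= 0] the exponent [- (eta * (y j - c))] is at most [eta * c],
    in the range of [expR_le_quad]. *)
Lemma ew_potential_step k L y c : eta * c <= 3^-1 -> (forall j, 0 <= y j) ->
  ew_potential k (fun j => L j + y j) <=
    ew_potential k L + y k - \sum_j ew_dist L j * y j +
    eta * \sum_j ew_dist L j * (y j - c) ^+ 2.
Proof.
move=> c3 y0; rewrite /ew_potential.
set q := ew_dist L; set W := ew_total L; set W' := ew_total _.
have W0 : 0 < W := ew_total_gt0 _; have W'0 : 0 < W' := ew_total_gt0 _.
have defW : W' = W * expR (- (eta * c)) * \sum_j q j * expR (- (eta * (y j - c))).
  rewrite mulr_sumr; apply: eq_bigr => j _.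
  rewrite (_ : - (eta * (L j + y j)) =
    - (eta * L j) + - (eta * c) + - (eta * (y j - c))); last by ring.
  by rewrite !expRD /q /ew_dist -/W; field; rewrite gt_eqF.
have X0 : 0 < \sum_j q j * expR (- (eta * (y j - c))).
  by move: W'0; rewrite defW pmulr_rgt0 // mulr_gt0 ?expR_gt0.
have lnX : ln (\sum_j q j * expR (- (eta * (y j - c)))) <=
    eta * c - eta * \sum_j q j * y j + eta ^+ 2 * \sum_j q j * (y j - c) ^+ 2.
  set X := \sum_j _ in X0 *.
  have : X - 1 <= eta * c - eta * \sum_j q j * y j + eta ^+ 2 * \sum_j q j * (y j - c) ^+ 2.
    rewrite lerBlDl.
    have -> : 1 + (eta * c - eta * (\sum_j q j * y j) +
        eta ^+ 2 * (\sum_j q j * (y j - c) ^+ 2)) =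
      \sum_j q j * (1 + - (eta * (y j - c)) + (- (eta * (y j - c))) ^+ 2).
      rewrite -[X in X + _](ew_dist_sum L) -[eta * c]mul1r -[in X in X * (eta * c)](ew_dist_sum L).
      rewrite mulr_suml !mulr_sumr -sumrB -!big_split /=.
      by apply: eq_bigr => j _; rewrite /q; ring.
    apply: ler_sum => j _; rewrite ler_wpM2l ?(ltW (ew_dist_gt0 _ _)) // expR_le_quad //.
    by have := mulr_ge0 (ltW eta_gt0) (y0 j); lra.
  apply: le_trans; have := @le_ln1Dx R (X - 1).
  by rewrite (addrC 1) subrK; apply; lra.
rewrite -(ler_pM2l eta_gt0) !(mulrDr eta) !(mulrCA eta _ eta^-1) mulfV ?gt_eqF // !mulr1.
rewrite mulrN [eta * (eta * _)]mulrA -expr2.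
rewrite defW !lnM ?posrE ?mulr_gt0 ?expR_gt0 // expRK; lra.
Qed.

Hypothesis obs_prob_gt0 : forall L j, 0 < obs_prob (ew_mix L) j.

Lemma loss_estimate_ge0 L lv i j : (forall j, 0 <= lv j) -> 0 <= loss_estimate L lv i j.
Proof.
by move=> lv0; rewrite divr_ge0 ?(ltW (obs_prob_gt0 _ _)) //; case: ifP.
Qed.

Lemma loss_estimate_mean L lv j :
  \sum_i ew_mix L i * loss_estimate L lv i j = lv j.
Proof.
rewrite (eq_bigr (fun i => (if G i j then ew_mix L i else 0) * (lv j / obs_prob (ew_mix L) j))).
  rewrite -mulr_suml -big_mkcond /= -/(obs_prob _ _).
  by rewrite mulrC divfK // gt_eqF.
by move=> i _; rewrite /loss_estimate; case: ifP => _; rewrite ?mul0r ?mulr0.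
Qed.

Lemma loss_estimate_square L lv j : 0 <= lv j <= 1 ->
  \sum_i ew_mix L i * loss_estimate L lv i j ^+ 2 <= (obs_prob (ew_mix L) j)^-1.
Proof.
move=> /andP[l0 l1].
rewrite (eq_bigr (fun i => (if G i j then ew_mix L i else 0) * (lv j / obs_prob (ew_mix L) j) ^+ 2)).
  rewrite -mulr_suml -big_mkcond /= -/(obs_prob _ _).
  set P := obs_prob _ _; have P0 : 0 < P := obs_prob_gt0 _ _.
  rewrite [leLHS](_ : _ = lv j ^+ 2 * P^-1); last by field; rewrite gt_eqF.
  by rewrite ler_piMl ?exprn_ile1 // invr_ge0 ltW.
by move=> i _; rewrite /loss_estimate; case: ifP => _; rewrite ?mul0r ?expr0n ?mulr0.
Qed.

Lemma ew_round k L lv (c : 'I_K -> R) :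
  (forall j, 0 <= lv j <= 1) -> (forall i, eta * c i <= 3^-1) ->
  \sum_i ew_mix L i * (lv i + ew_potential k (fun j => L j + loss_estimate L lv i j)) <=
  lv k + ew_potential k L + (gamma + eta *
    \sum_i ew_mix L i * \sum_j ew_dist L j * (loss_estimate L lv i j - c i) ^+ 2).
Proof.
move=> lv01 c3; have lv0 j : 0 <= lv j by case/andP: (lv01 j).
set y := loss_estimate L lv; set p := ew_mix L; set q := ew_dist L.
pose rest i := lv i + (ew_potential k L + y i k - \sum_j q j * y i j +
    eta * \sum_j q j * (y i j - c i) ^+ 2).
apply: (@le_trans _ _ (\sum_i p i * rest i)).
  apply: ler_sum => i _; rewrite ler_wpM2l ?(ltW (ew_mix_gt0 _ _)) // lerD2l.
  by apply: ew_potential_step => // j; exact: loss_estimate_ge0.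
have -> : \sum_i p i * rest i = \sum_i p i * lv i + ew_potential k L + lv k -
    \sum_j q j * lv j + eta * \sum_i p i * \sum_j q j * (y i j - c i) ^+ 2.
  have -> : \sum_j q j * lv j = \sum_i p i * \sum_j q j * y i j.
    under [RHS]eq_bigr do rewrite mulr_sumr.
    rewrite exchange_big /=; apply: eq_bigr => j _.
    by rewrite -(loss_estimate_mean L lv j) mulr_sumr; apply: eq_bigr => i _; rewrite mulrCA.
  rewrite -(loss_estimate_mean L lv k) -[ew_potential k L]mul1r -(ew_mix_sum L).
  rewrite mulr_suml mulr_sumr -!big_split /= -sumrB -big_split /=.
  by apply: eq_bigr => i _; rewrite /rest /p /y; ring.
(* Price of exploration: [p i - q i = gamma * (u i - q i)] and losses lie in [[0, 1]]. *)
suff : \sum_i p i * lv i - \sum_j q j * lv j <= gamma by lra.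
rewrite -sumrB (eq_bigr (fun i => gamma * (u i * lv i) - gamma * (q i * lv i))); last first.
  by move=> i _; rewrite /p /ew_mix -/q; ring.
rewrite sumrB -!mulr_sumr.
have : \sum_i u i * lv i <= 1.
  rewrite -u_sum; apply: ler_sum => i _; rewrite ler_piMr //.
  by case/andP: (lv01 i).
have : 0 <= \sum_i q i * lv i.
  by apply: sumr_ge0 => i _; rewrite mulr_ge0 // ltW // ew_dist_gt0.
have := gamma_gt0; nra.
Qed.

(** The centres [c] are chosen in the analysis, after [L] and the losses, separately for each played
    action; the strategy does not use them. *)
Lemma ew_regret (V : R) T l k : admissible_losses l ->
  (forall L lv, (forall j, 0 <= lv j <= 1) ->
    exists2 c : 'I_K -> R, forall i, eta * c i <= 3^-1 &
    \sum_i ew_mix L i * \sum_j ew_dist L j * (loss_estimate L lv i j - c i) ^+ 2 <= V) ->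
  exp_loss G ew_strategy l [::] 0 T <=
    cum_loss l T k + (ln K%:R / eta + T%:R * (gamma + eta * V)).
Proof.
move=> al HV.
have := @exp_loss_potential R K G ew_strategy l k (gamma + eta * V)
  (fun h => ew_potential k (foldl ew_update (fun=> 0) h)) ew_valid.
move=> /(_ (fun h => ew_potential_ge0 _ _)) H.
have {}H := H _ T [::] 0%N; apply: (le_trans (H _)); last first.
  (* At [L = 0] all weights are [1], so the initial potential is [ln K / eta]. *)
  rewrite /= -addrA lerD2l lerD2r /ew_potential add0r ler_pM2r ?invr_gt0 //.
  rewrite /ew_total (eq_bigr (fun=> 1)) ?sumr_const ?card_ord // => j _.
  by rewrite mulr0 oppr0 expR0.
move=> h t; have [c c3 Hc] := HV (foldl ew_update (fun=> 0) h) (l t) (al t).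
have := ew_round k (foldl ew_update (fun=> 0) h) (al t) c3.
rewrite (eq_bigr (fun i => ew_strategy h i * (l t i +
  ew_potential k (foldl ew_update (fun=> 0) (rcons h (feedback G l t i)))))); last first.
  by move=> i _; rewrite foldl_rcons.
move=> /le_trans; apply; rewrite lerD2l lerD2l ler_pM2l //.
Qed.
End ExponentialWeights.

(** * Weakly dominating sets of minimum size *)

Section Domination.
Variables (K : nat) (G : rel 'I_K).
Implicit Types D : {set 'I_K}.

Lemma weak_domination_number_le D : weakly_dominating G D ->
  (weak_domination_number G <= #|D|)%N.
Proof.
move=> domD; rewrite /weak_domination_number.
have : D \in index_enum {set 'I_K} by rewrite mem_index_enum.
elim: (index_enum _) => //= E r IH; rewrite inE => /predU1P[<-|Dr]; rewrite big_cons.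
  by rewrite domD geq_minl.
by case: ifP => _; [rewrite geq_min IH ?orbT|exact: IH].
Qed.

Lemma weakly_dominating_setT : weakly_dominating G [set: 'I_K].
Proof.
apply/forallP => w; apply/implyP => /andP[/existsP[j Gjw] _].
by apply/exists_inP; exists j.
Qed.

Lemma weak_domination_witness :
  exists2 D, weakly_dominating G D & #|D| = weak_domination_number G.
Proof.
case: (@arg_minnP _ [set: 'I_K] (weakly_dominating G) (fun D => #|D|) weakly_dominating_setT)
  => D domD minD; exists D => //; apply/eqP; rewrite eqn_leq weak_domination_number_le // andbT.
apply: (big_ind (fun n => (#|D| <= n)%N)) => //.
  (* The seed [K] of the minimum does not lower it. *)
  by rewrite -[leqRHS]card_ord max_card.
by move=> m n Dm Dn; rewrite leq_min Dm.
Qed.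

Lemma exists_weakly_observable : weakly_observable G ->
  exists w, weakly_observable_vertex G w.
Proof.
move=> /andP[/forallP obs /forallPn[w Hw]]; exists w.
by rewrite /weakly_observable_vertex obs Hw.
Qed.

Lemma weak_domination_number_gt0 : weakly_observable G ->
  (0 < weak_domination_number G)%N.
Proof.
move=> /exists_weakly_observable[w ww].
have [D domD <-] := weak_domination_witness; rewrite card_gt0; apply/set0Pn.
by move/forallP/(_ w)/implyP/(_ ww)/exists_inP : domD => [d dD _]; exists d.
Qed.
End Domination.

(** * Second moments of the loss estimates *)

Section Variance.
Variables (R : realType) (K : nat) (G : rel 'I_K).
Hypothesis K_gt0 : (0 < K)%N.
Variables (eta gamma : R) (u : 'I_K -> R).
Hypotheses (eta_gt0 : 0 < eta) (gamma_gt0 : 0 < gamma) (gamma_le : gamma <= 2^-1).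
Hypotheses (u_ge0 : forall i, 0 <= u i) (u_sum : \sum_i u i = 1).
Let q := @ew_dist R K eta.
Let p := ew_mix eta gamma u.
Let P L := obs_prob G (p L).
Let yhat := loss_estimate G eta gamma u.

Let p_gt0 L i : 0 < p L i.
Proof. exact: ew_mix_gt0. Qed.

Let p_ge_exploration L i : gamma * u i <= p L i.
Proof.
rewrite /p /ew_mix lerDr mulr_ge0 ?(ltW (ew_dist_gt0 _ _ _ _)) //.
by have := gamma_le; lra.
Qed.

Lemma obs_prob_ge L i j : G i j -> p L i <= P L j.
Proof.
move=> Gij; rewrite /P /obs_prob (bigD1 i) //= lerDl.
by apply: sumr_ge0 => k _; exact/ltW.
Qed.

Lemma obs_prob_loopless L j : ~~ G j j -> strongly_observable_vertex G j ->
  P L j = 1 - p L j.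
Proof.
move=> Gjj; rewrite /strongly_observable_vertex (negPf Gjj) /= => /forallP H.
rewrite -(ew_mix_sum K_gt0 eta gamma u_sum L) [X in _ = X - _](bigD1 j) //=.
rewrite addrAC subrr add0r; apply: eq_bigl => i.
have [->|ij] := eqVneq i j; first by rewrite (negPf Gjj).
by have := H i; rewrite ij.
Qed.

Hypothesis P_gt0 : forall L j, 0 < P L j.

Lemma second_moment_le L lv (Q : pred 'I_K) : (forall j, 0 <= lv j <= 1) ->
  \sum_i p L i * (\sum_(j | Q j) q L j * yhat L lv i j ^+ 2) <=
  \sum_(j | Q j) q L j / P L j.
Proof.
move=> lv01; under eq_bigr do rewrite mulr_sumr.
rewrite exchange_big /=; apply: ler_sum => j _.
under eq_bigr do rewrite mulrCA.
rewrite -mulr_sumr ler_wpM2l ?(ltW (ew_dist_gt0 _ _ _ _)) //.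
exact: loss_estimate_square.
Qed.

Lemma dist_ratio_le L j : G j j -> q L j / P L j <= 2.
Proof.
move=> Gjj; rewrite ler_pdivrMr // (le_trans (ew_dist_le_mix _ _ gamma_gt0 _ u_ge0 _ _)) //.
by rewrite ler_pM2l // obs_prob_ge.
Qed.

Lemma explored_variance (beta : R) : 0 < beta ->
  (forall L j, G j j \/ beta <= P L j) ->
  forall L lv, (forall j, 0 <= lv j <= 1) ->
  exists2 c : 'I_K -> R, forall i, eta * c i <= 3^-1 &
    \sum_i p L i * (\sum_j q L j * (yhat L lv i j - c i) ^+ 2) <= K%:R * 2 + beta^-1.
Proof.
move=> b0 Hb L lv lv01; exists (fun=> 0) => [i|]; first by rewrite mulr0 invr_ge0.
under eq_bigr do under eq_bigr do rewrite subr0.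
apply: (le_trans (second_moment_le _ (fun=> true) lv01)) => /=.
apply: (@le_trans _ _ (\sum_j (2 + q L j * beta^-1))).
  apply: ler_sum => j _; have q0 := ew_dist_gt0 K_gt0 eta L j.
  have [/dist_ratio_le/le_trans->//|bP] := Hb L j.
    by rewrite lerDl mulr_ge0 ?invr_ge0 ?ltW.
  rewrite ler_wpDl // ler_pM2l // lef_pV2 ?posrE //.
rewrite big_split /= sumr_const card_ord -mulr_suml ew_dist_sum // mul1r.
by rewrite mulr_natl.
Qed.

Let alpha : R := (independence_number G)%:R.

(** On the set [A] of vertices with a loop, [q <= 2 * p], and [P] is at least the closed in-weight
    within [A] because the loop makes [j] reveal itself; [in_weight_sum] then applies. Each
    remaining vertex costs at most [2 * q]. *)
Lemma strong_ratio_sum (eps : R) L (Q : pred 'I_K) : 0 < eps -> eps <= 1 ->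
  (forall i, eps <= p L i) -> (forall j, Q j -> G j j \/ 2^-1 <= P L j) ->
  \sum_(j | Q j) q L j / P L j <= 4 * alpha * (1 + ln eps^-1) + 2.
Proof.
move=> e0 e1 pe HQ; pose A := [set j | G j j].
have q0 j := ew_dist_gt0 K_gt0 eta L j.
have H : \sum_(j in A) p L j / in_weight G (p L) A j <= 2 * alpha * (1 + ln eps^-1).
  apply: in_weight_sum => //.
  rewrite -(ew_mix_sum K_gt0 eta gamma u_sum L) [leRHS](bigID (mem A)) /= lerDl.
  by apply: sumr_ge0 => i _; exact/ltW.
apply: (@le_trans _ _ (\sum_j ((if j \in A then 2 * (p L j / in_weight G (p L) A j) else 0) + q L j * 2))).
  rewrite big_mkcond; apply: ler_sum => j _; rewrite inE.
  have qj0 := q0 j; have Pj0 := P_gt0 L j.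
  have In0 : G j j -> 0 < in_weight G (p L) A j.
    move=> Gjj; apply: (lt_le_trans (p_gt0 L j)).
    by apply: in_weight_ge => [i _|]; [exact: p_gt0|rewrite inE].
  have ge0 : 0 <= (if G j j then 2 * (p L j / in_weight G (p L) A j) else 0).
    by case: ifP => // /In0 In0'; rewrite mulr_ge0 // divr_ge0 // ltW.
  case: ifP => [Qj|_]; last by rewrite addr_ge0 // mulr_ge0 // ltW.
  have [Gjj|Pj] := HQ _ Qj.
    rewrite Gjj; apply: ler_wpDr; first by rewrite pmulr_lge0 // ltW.
    rewrite mulrA.
    apply: ler_pM; rewrite ?invr_ge0 ?(ltW qj0) ?(ltW Pj0) //.
      exact: ew_dist_le_mix.
    rewrite lef_pV2 ?posrE ?In0 // /in_weight /P /obs_prob big_mkcond [leRHS]big_mkcond.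
    apply: ler_sum => i _; rewrite inE; have := p_gt0 L i.
    case: eqVneq => [->|_]; first by rewrite Gjj.
    by case: (G i i); case: (G i j) => //= /ltW.
  rewrite ler_wpDl // ler_pM2l // -[X in _ <= X]invrK lef_pV2 ?posrE // invr_gt0 //.
rewrite big_split /= -mulr_suml ew_dist_sum // mul1r lerD2r -big_mkcond /= -mulr_sumr.
rewrite (_ : 4 * _ * _ = 2 * (2 * alpha * (1 + ln eps^-1))); last by ring.
by rewrite ler_pM2l.
Qed.

Hypothesis K_gt1 : (1 < K)%N.
Hypothesis u_unif : forall i, u i = K%:R^-1.
Hypothesis eta_gamma : 6 * eta <= gamma.

(* A loopless vertex [j0] played with probability above 1/2 is observed too
   rarely; subtracting its own loss estimate from all estimates removes its
   contribution to the variance. *)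
Lemma strong_variance : strongly_observable G ->
  forall L lv, (forall j, 0 <= lv j <= 1) ->
  exists2 c : 'I_K -> R, forall i, eta * c i <= 3^-1 &
    \sum_i p L i * (\sum_j q L j * (yhat L lv i j - c i) ^+ 2) <=
    4 * alpha * (1 + ln (K%:R / gamma)) + 4.
Proof.
move=> /forallP strong L lv lv01.
have K0 : 0 < K%:R :> R by rewrite ltr0n.
have q0 j := ew_dist_gt0 K_gt0 eta L j.
have eps0 : 0 < gamma / K%:R by rewrite divr_gt0.
have eps1 : gamma / K%:R <= 1.
  rewrite ler_pdivrMr // mul1r (@le_trans _ _ 1) ?ler1n //.
  by have := gamma_le; lra.
have pe i : gamma / K%:R <= p L i by rewrite -(u_unif i) p_ge_exploration.
have Hsum Q := @strong_ratio_sum _ L Q eps0 eps1 pe.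
rewrite invf_div in Hsum.
have [/existsP[j0 /andP[Gj0 pj0]]|/existsPn none] :=
  boolP [exists j, ~~ G j j && (2^-1 < p L j)]; last first.
  exists (fun=> 0) => [i|]; first by rewrite mulr0 invr_ge0.
  under eq_bigr do under eq_bigr do rewrite subr0.
  apply: (le_trans (second_moment_le _ (fun=> true) lv01)) => /=.
  apply: (@le_trans _ _ (4 * alpha * (1 + ln (K%:R / gamma)) + 2)); last by lra.
  apply: Hsum => j _; have := none j; case Gjj : (G j j); first by left.
  by rewrite /= -leNgt => pj; right; rewrite obs_prob_loopless ?Gjj //; lra.
have defP := obs_prob_loopless L Gj0 (strong j0).
have Pj00 := P_gt0 L j0.
(* Here [P L j0 = (1 - gamma) * (1 - q L j0) + gamma * (1 - K^-1)], and both coefficients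
   [1 - gamma] and [1 - K^-1] are at least [1 / 2]. *)
have Pq : 1 - q L j0 <= 2 * P L j0 /\ gamma / 2 <= P L j0.
  rewrite defP /p /ew_mix u_unif -/q.
  have qj01 : q L j0 <= 1.
    rewrite -(ew_dist_sum K_gt0 eta L) (bigD1 j0) //= lerDl.
    by apply: sumr_ge0 => i _; exact/ltW.
  have K2 : K%:R^-1 <= 2^-1 :> R by rewrite lef_pV2 ?posrE // ler_nat.
  by have := gamma_gt0; have := gamma_le; split; nra.
exists (fun i => yhat L lv i j0) => [i|].
  (* With [6 * eta <= gamma] this yields [eta * c i <= 1 / 3]. *)
  have : yhat L lv i j0 <= 2 / gamma.
    rewrite /yhat /loss_estimate; apply: (@le_trans _ _ (1 / P L j0)).
      rewrite ler_pM2r ?invr_gt0 //.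
      by case: ifP => _ //; case/andP: (lv01 j0).
    rewrite mul1r -[2 / gamma]invrK invf_div lef_pV2 ?posrE ?divr_gt0 //.
    by case: Pq.
  move=> /(ler_wpM2l (ltW eta_gt0))/le_trans; apply.
  by rewrite mulrA ler_pdivrMr //; have := eta_gamma; lra.
have y_ge0 i j : 0 <= yhat L lv i j.
  by apply: loss_estimate_ge0 => // k; case/andP: (lv01 k).
(* The summand of [j0] vanishes after centring; elsewhere the square of a difference of nonnegative
   numbers is at most the sum of their squares. *)
apply: (@le_trans _ _ (\sum_i p L i * (\sum_(j | j != j0) q L j * yhat L lv i j ^+ 2) +
    \sum_i p L i * ((1 - q L j0) * yhat L lv i j0 ^+ 2))).
  rewrite -big_split /=; apply: ler_sum => i _; rewrite -mulrDr ler_wpM2l ?(ltW (p_gt0 _ _)) //.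
  rewrite (bigD1 j0) //= subrr expr0n mulr0 add0r.
  have -> : 1 - q L j0 = \sum_(j | j != j0) q L j.
    by rewrite -(ew_dist_sum K_gt0 eta L) (bigD1 j0) //= addrAC subrr add0r.
  rewrite mulr_suml -big_split /=; apply: ler_sum => j _; rewrite -mulrDr ler_pM2l // sqrrB.
  by have := mulr_ge0 (y_ge0 i j) (y_ge0 i j0); lra.
have Hself : \sum_i p L i * ((1 - q L j0) * yhat L lv i j0 ^+ 2) <= 2.
  under eq_bigr do rewrite mulrCA.
  rewrite -mulr_sumr; apply: (@le_trans _ _ ((1 - q L j0) / P L j0)).
    rewrite ler_wpM2l ?loss_estimate_square // subr_ge0.
    rewrite -(ew_dist_sum K_gt0 eta L) [leRHS](bigD1 j0) //= lerDl.
    by apply: sumr_ge0 => i _; exact/ltW.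
  by rewrite ler_pdivrMr //; case: Pq.
suff : \sum_i p L i * (\sum_(j | j != j0) q L j * yhat L lv i j ^+ 2) <=
    4 * alpha * (1 + ln (K%:R / gamma)) + 2 by lra.
apply: (le_trans (second_moment_le _ (fun j => j != j0) lv01)).
apply: Hsum => j jj0; case Gjj : (G j j); first by left.
right; rewrite obs_prob_loopless ?Gjj //.
(* As [j0] has more than half of the mass, any other loopless vertex is observed with probability at
   least [1 / 2]. *)
have : p L j + p L j0 <= 1.
  rewrite -(ew_mix_sum K_gt0 eta gamma u_sum L) (bigD1 j0) //= (bigD1 j) //=.
  suff : 0 <= \sum_(i | (i != j0) && (i != j)) p L i by rewrite /p; lra.
  by apply: sumr_ge0 => i _; exact/ltW/p_gt0.
lra.
Qed.
End Variance.

(** * Upper bounds *)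

Section UpperBounds.
Variables (R : realType) (K : nat) (G : rel 'I_K) (T : nat).
Hypotheses (K_ge2 : (2 <= K)%N) (KT : (K ^ 3 <= T)%N).
Let Lam : R := ln (K * T)%:R.

Let K_gt0 : (0 < K)%N. Proof. exact: ltnW. Qed.

Let T_ge_K : (K <= T)%N.
Proof. by apply: leq_trans KT; rewrite -{1}(expn1 K) leq_pexp2l. Qed.

Let T_gt0 : (0 < T)%N. Proof. exact: leq_trans T_ge_K. Qed.

(** From [K * T >= 2 ^ 4] and [ln 2 >= 1 / 2]. It allows additive constants to be absorbed into
    [Lam]. *)
Lemma ln_KT_ge1 : 1 <= Lam.
Proof.
have H : 2 ^+ 4 <= (K * T)%:R :> R.
  rewrite -natrX ler_nat (leq_trans _ (leq_mul K_ge2 KT)) //.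
  by rewrite (@leq_trans (2 * 2 ^ 3)) // leq_pmul2l // leq_exp2r.
have : ln (2 ^+ 4) <= Lam by rewrite ler_ln ?posrE ?exprn_gt0 ?(lt_le_trans _ H) // exprn_gt0.
have := @ln_ge1BV R 2 (ltr0n _ _); rewrite lnXn // -mulr_natl; lra.
Qed.

Lemma ln_K_le : ln K%:R <= Lam.
Proof.
by rewrite ler_ln ?posrE ?ltr0n ?muln_gt0 ?K_gt0 // ler_nat leq_pmulr.
Qed.

Lemma minimax_regret_leT : minimax_regret R G T <= T%:R.
Proof.
have v : @valid_strategy R K (fun _ i => (i == Ordinal K_gt0)%:R).
  move=> h; split=> [i|]; first exact: ler0n.
  by rewrite (bigD1 (Ordinal K_gt0)) //= big1 ?addr0 => [|i /negPf -> //].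
apply: (minimax_regret_le K_gt0 v) => l k al.
by rewrite ler_wpDl ?cum_loss_ge0 // exp_loss_le.
Qed.

Let alpha : R := (independence_number G)%:R.

Lemma strong_upper : strongly_observable G ->
  minimax_regret R G T <= 16 * Num.sqrt (alpha * T%:R) * Lam.
Proof.
move=> strong; have alpha1 : 1 <= alpha by rewrite ler1n independence_number_gt0.
set t : R := T%:R; set s := Num.sqrt (alpha * t).
have t0 : 0 < t by rewrite ltr0n.
have alphaT : alpha <= t.
  rewrite ler_nat (leq_trans _ T_ge_K) //; apply/bigmax_leqP => S _.
  by rewrite -[leqRHS]card_ord max_card.
have ss : s ^+ 2 = alpha * t by rewrite sqr_sqrtr // mulr_ge0 // ltW // (lt_le_trans ltr01).
have s0 : 0 < s by rewrite sqrtr_gt0 mulr_gt0 // (lt_le_trans ltr01).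
have s1 : 1 <= s.
  have t1 : 1 <= t by rewrite ler1n.
  by have := ss; nra.
have st : s <= t by have := ss; nra.
have K0 : 0 < K%:R :> R by rewrite ltr0n.
(* The order [1 / s] balances [ln K / eta] against [eta * alpha * T]; the constants give
   [6 * eta = gamma] and, as [s >= 1], [gamma <= 1 / 2]. *)
pose eta := (12 * s)^-1; pose gamma := (2 * s)^-1.
have eta0 : 0 < eta by rewrite invr_gt0 mulr_gt0.
have gamma0 : 0 < gamma by rewrite invr_gt0 mulr_gt0.
have gamma_le : gamma <= 2^-1 by rewrite lef_pV2 ?posrE ?mulr_gt0 // ler_peMr.
have u0 i : 0 <= (fun _ : 'I_K => K%:R^-1 : R) i by rewrite invr_ge0 ltW.
have u1 : \sum_i (fun _ : 'I_K => K%:R^-1 : R) i = 1.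
  by rewrite sumr_const card_ord -[LHS]mulr_natl mulfV ?gt_eqF.
have eg : 6 * eta <= gamma.
  by rewrite le_eqVlt; apply/orP; left; apply/eqP; rewrite /eta /gamma; field; rewrite gt_eqF.
have obs L i j : G i j -> 0 < obs_prob G (ew_mix eta gamma (fun _ : 'I_K => K%:R^-1 : R) L) j.
  by move=> Gij; apply: lt_le_trans (obs_prob_ge _ _ _ _ _ _ Gij) => //; exact: ew_mix_gt0.
have P0 L j : 0 < obs_prob G (ew_mix eta gamma (fun _ : 'I_K => K%:R^-1 : R) L) j.
  have [Gjj|Gjj] := boolP (G j j); first exact: (obs L j).
  have [k kj] : exists k, k != j.
    case: (eqVneq j (Ordinal K_gt0)) => [->|]; last by rewrite eq_sym; exists (Ordinal K_gt0).
    by exists (Ordinal K_ge2).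
  have Gkj : G k j.
    have := forallP strong j; rewrite /strongly_observable_vertex (negPf Gjj) /=.
    by move=> /forallP/(_ k); rewrite kj.
  exact: (obs L k).
have V := @strong_variance R K G K_gt0 eta gamma _ eta0 gamma0 gamma_le u0 u1 P0 K_ge2 (fun=> erefl) eg strong.
apply: (@minimax_regret_le R K G _ T _ K_gt0 (@ew_valid R K G K_gt0 eta gamma _ gamma0 gamma_le u0 u1)) => l k al.
apply: (le_trans (ew_regret K_gt0 eta0 gamma0 gamma_le u0 u1 P0 T k al V)).
rewrite lerD2l -/alpha.
have lnb : ln (K%:R / gamma) <= 2 * Lam.
  rewrite /Lam [leRHS]mulr_natl -lnXn ?ltr0n ?muln_gt0 ?K_gt0 // ler_ln ?posrE ?divr_gt0 ?exprn_gt0 ?ltr0n ?muln_gt0 ?K_gt0 //.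
  rewrite /gamma invrK natrM -/t.
  have K2 : 2 <= K%:R :> R by rewrite ler_nat.
  have t1 : 1 <= t by rewrite ler1n.
  apply: (@le_trans _ _ ((K%:R * t) * (2 * 1))).
    by rewrite -mulrA ler_pM2l // mulr1 mulrC ler_pM2r.
  by rewrite expr2 ler_pM2l ?mulr_gt0 // ler_pM.
have L1 := ln_KT_ge1; have lnK := ln_K_le.
have -> : t * (gamma + eta * (4 * alpha * (1 + ln (K%:R / gamma)) + 4)) =
   (alpha * t) / s * (2^-1 / alpha + (1 + ln (K%:R / gamma)) / 3 + (3 * alpha)^-1).
  by rewrite /gamma /eta; field; rewrite !gt_eqF // (lt_le_trans ltr01).
rewrite -ss /eta invrK expr2 mulfK ?gt_eqF //.
have ainv : alpha^-1 <= 1 by rewrite invf_le1 // (lt_le_trans ltr01).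
rewrite (_ : (3 * alpha)^-1 = alpha^-1 / 3); last by rewrite invfM mulrC.
rewrite (_ : _ + _ = s * (12 * ln K%:R + 2^-1 / alpha + (1 + ln (K%:R / gamma)) / 3 + alpha^-1 / 3)); last by ring.
rewrite (_ : 16 * s * Lam = s * (16 * Lam)); last by ring.
by rewrite ler_pM2l //; clear u0; lra.
Qed.

Let delta : R := (weak_domination_number G)%:R.

Lemma weak_upper : weakly_observable G ->
  minimax_regret R G T <= 12 * (powR delta (1 / 3) * powR T%:R (2 / 3)) * Lam.
Proof.
move=> weak; have := weak_domination_number_gt0 weak; rewrite -(ler_nat R) -/delta => delta1.
have [D domD cD] := weak_domination_witness G.
have d0 : 0 < delta by exact: lt_le_trans delta1.
have t0 : 0 < T%:R :> R by rewrite ltr0n.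
set s := powR delta (1 / 3); pose t : R := powR T%:R (1 / 3).
have cube x : 0 < x -> powR x (1 / 3) ^+ 3 = x :> R.
  by move=> x0; rewrite -powR_mulrn ?powR_ge0 // -powRrM (_ : 1 / 3 * 3%:R = 1) ?powRr1 ?ltW //; field.
have s3 : s ^+ 3 = delta by exact: cube.
have t3 : t ^+ 3 = T%:R by exact: cube.
have s_gt0 : 0 < s by exact: powR_gt0.
have t_gt0 : 0 < t by exact: powR_gt0.
have -> : powR T%:R (2 / 3) = t ^+ 2.
  by rewrite -powR_mulrn ?powR_ge0 // -powRrM; congr powR; field.
have s1 : 1 <= s.
  by rewrite -(powRr0 delta); apply: ler_powR => //; lra.
have K0 : 0 < K%:R :> R by rewrite ltr0n.
(* This is where [T >= K ^ 3] enters: it makes the variance [2 * K] of the vertices with a loop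
   negligible. *)
have K_le_t : K%:R <= t.
  rewrite -(ler_pXn2r (n := 3)) ?nnegrE ?(ltW t_gt0) ?(ltW K0) //.
  by rewrite t3 -natrX ler_nat.
have s_le_t : s <= t.
  have dT : delta <= T%:R.
    by rewrite /delta ler_nat -cD (leq_trans _ T_ge_K) // -[leqRHS]card_ord max_card.
  by apply: ge0_ler_powR; rewrite ?nnegrE ?(ltW d0) ?(ltW t0) ?divr_ge0.
(* A loopless strongly observable vertex is revealed by every other vertex, hence by at least one of
   [a] and [b]. *)
pose a := Ordinal K_gt0; pose b := Ordinal K_ge2.
pose D' := a |: (b |: D).
have cD'0 : (0 < #|D'|)%N by rewrite card_gt0; apply/set0Pn; exists a; rewrite !inE eqxx.
have cD' : #|D'|%:R <= 3 * delta.
  have : #|D'|%:R <= 2 + delta.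
    rewrite /delta -cD -(natrD _ 2) ler_nat /D' !cardsU1.
    by case: (a \notin _); case: (b \notin _) => /=; rewrite !addnA ?leq_addl.
  lra.
have D'0 : 0 < #|D'|%:R :> R by rewrite ltr0n.
pose u i : R := (i \in D')%:R / #|D'|%:R.
have u0 i : 0 <= u i by rewrite divr_ge0.
have u1 : \sum_i u i = 1.
  rewrite -mulr_suml (_ : \sum_i _ = #|D'|%:R) ?mulfV ?gt_eqF //.
  by rewrite -sum1_card natr_sum [RHS]big_mkcond; apply: eq_bigr => i _; case: ifP.
(* With [s ^+ 3 = delta] and [t ^+ 3 = T], the terms [1 / eta], [T * gamma] and [T * eta / beta] all
   have order [s * t ^+ 2]; [beta] bounds the exploration mass of each vertex of [D'] from below. *)
pose eta := (s * t ^+ 2)^-1; pose gamma := s / (2 * t); pose beta := gamma / (3 * delta).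
have eta0 : 0 < eta by rewrite invr_gt0 mulr_gt0 // exprn_gt0.
have gamma0 : 0 < gamma by rewrite divr_gt0 // mulr_gt0.
have gamma_le : gamma <= 2^-1 by rewrite ler_pdivrMr ?mulr_gt0 // mulrA mulVf // mul1r.
have beta0 : 0 < beta by rewrite divr_gt0 // mulr_gt0.
have expl L i j : i \in D' -> G i j -> beta <= obs_prob G (ew_mix eta gamma u L) j.
  move=> iD Gij; apply: le_trans (obs_prob_ge K_gt0 eta gamma0 gamma_le u0 L Gij).
  rewrite /ew_mix ler_wpDl //.
    by rewrite mulr_ge0 ?(ltW (ew_dist_gt0 _ _ _ _)) //; lra.
  by rewrite /beta ler_pM2l // /u iD mul1r lef_pV2 ?posrE // mulr_gt0.
have HP L j : G j j \/ beta <= obs_prob G (ew_mix eta gamma u L) j.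
  case Gjj : (G j j); [by left|right].
  case: (boolP (strongly_observable_vertex G j)) => [|nsj].
    rewrite /strongly_observable_vertex Gjj /= => /forallP H.
    case: (eqVneq j a) => [ja|ja].
      apply: (expl _ b); rewrite ?inE ?eqxx ?orbT //.
      by have := H b; rewrite ja; apply.
    apply: (expl _ a); rewrite ?inE ?eqxx ?orbT //.
    by have := H a; rewrite eq_sym ja.
  have wj : weakly_observable_vertex G j.
    by rewrite /weakly_observable_vertex nsj andbT; case/andP: weak => /forallP.
  have /exists_inP[d dD Gdj] := implyP (forallP domD j) wj.
  by apply: (expl _ d) => //; rewrite !inE dD !orbT.
have P0 L j : 0 < obs_prob G (ew_mix eta gamma u L) j.
  have [Gjj|] := HP L j; last exact: lt_le_trans.
  by apply: lt_le_trans (obs_prob_ge _ _ _ _ _ _ Gjj) => //; exact: ew_mix_gt0.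
have V := @explored_variance R K G K_gt0 eta gamma u gamma0 gamma_le u0 P0 beta beta0 HP.
apply: (@minimax_regret_le R K G _ T _ K_gt0 (@ew_valid R K G K_gt0 eta gamma _ gamma0 gamma_le u0 u1)) => l k al.
apply: (le_trans (ew_regret K_gt0 eta0 gamma0 gamma_le u0 u1 P0 T k al V)).
rewrite lerD2l.
have L1 := ln_KT_ge1; have lnK := ln_K_le.
have -> : ln K%:R / eta + T%:R * (gamma + eta * (K%:R * 2 + beta^-1)) =
  s * t ^+ 2 * ln K%:R + s * t ^+ 2 / 2 + 2 * (K%:R * t) / s + 6 * (s * t ^+ 2).
  by rewrite /beta /gamma /eta -s3 -t3; field; rewrite !gt_eqF.
have Kt : K%:R * t / s <= s * t ^+ 2.
  rewrite ler_pdivrMr // mulrAC expr2 mulrA ler_pM2r // (le_trans K_le_t) //.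
  by rewrite ler_peMl ?(ltW t_gt0) // mulr_ege1.
have st0 : 0 < s * t ^+ 2 by rewrite mulr_gt0 // exprn_gt0.
have : s * t ^+ 2 * ln K%:R <= s * t ^+ 2 * Lam by rewrite ler_pM2l.
have : s * t ^+ 2 <= s * t ^+ 2 * Lam by rewrite ler_peMr // ltW.
lra.
Qed.
End UpperBounds.

(** * Stochastic environments *)

Lemma weighted_max (R : realType) (I : finType) (w f : I -> R) :
  (forall i, 0 <= w i) -> \sum_i w i = 1 -> exists i, \sum_j w j * f j <= f i.
Proof.
move=> w0 w1; have [/existsP[i Hi]|/existsPn H] :=
  boolP [exists i, \sum_j w j * f j <= f i]; first by exists i.
have lt i : f i < \sum_j w j * f j by rewrite ltNge.
have [i wi] : exists i, 0 < w i.
  have [/existsP //|/existsPn wn] := boolP [exists i, 0 < w i]; have := oner_neq0 R.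
  rewrite -w1 big1 ?eqxx // => i _; apply/eqP.
  by rewrite eq_le w0 andbT leNgt.
set m := \sum_j w j * f j in lt *.
suff : m < \sum_i w i * m.
  by rewrite -mulr_suml w1 mul1r ltxx.
rewrite {1}/m (bigD1 i) // [ltRHS](bigD1 i) //=; apply: ltr_leD; first by rewrite ltr_pM2l ?lt.
by apply: ler_sum => j _; rewrite ler_wpM2l // ltW.
Qed.

Section StochasticGame.
Variables (R : realType) (K : nat) (G : rel 'I_K) (X : finType) (loss : X -> 'I_K -> R).
Variable p : strategy R K.
Hypothesis p_valid : valid_strategy p.
Implicit Types (mu : X -> R) (g : 'I_K -> X -> R).

Definition sfeedback (x : X) (i : 'I_K) : obs R K :=
  (i, fun j => if G i j then loss x j else 0).

(* Expectation of [\sum_t g i_t x_t] when the [x_t] are drawn i.i.d. from [mu]. *)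
Fixpoint ev mu g (h : seq (obs R K)) n : R :=
  match n with
  | 0 => 0
  | n'.+1 => \sum_i p h i * \sum_x mu x * (g i x + ev mu g (rcons h (sfeedback x i)) n')
  end.

Section Law.
Variable mu : X -> R.
Hypotheses (mu_ge0 : forall x, 0 <= mu x) (mu_sum : \sum_x mu x = 1).

Lemma round_const h (c : R) : \sum_i p h i * (\sum_x mu x * c) = c.
Proof. by rewrite -mulr_suml (p_valid h).2 -mulr_suml mu_sum !mul1r. Qed.

Lemma ev_const (c : R) h n : ev mu (fun _ _ => c) h n = n%:R * c.
Proof.
elim: n h => [|n IH] h /=; first by rewrite mul0r.
under eq_bigr do under eq_bigr do rewrite IH.
by rewrite round_const -natr1; ring.
Qed.

Lemma ev_lin (c : R) g1 g2 h n :
  ev mu (fun i x => g1 i x + c * g2 i x) h n = ev mu g1 h n + c * ev mu g2 h n.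
Proof.
elim: n h => [|n IH] h /=; first by rewrite mulr0 addr0.
rewrite mulr_sumr -big_split; apply: eq_bigr => i _ /=.
rewrite mulrCA -mulrDr; congr (_ * _).
rewrite mulr_sumr -big_split; apply: eq_bigr => x _ /=.
by rewrite IH; ring.
Qed.

(** The draw of a round is independent of the action, so only the means under [mu] matter; random
    losses can thus be traded for their gaps. *)
Lemma ev_mono g1 g2 h n : (forall i, \sum_x mu x * g1 i x <= \sum_x mu x * g2 i x) ->
  ev mu g1 h n <= ev mu g2 h n.
Proof.
move=> le; elim: n h => //= n IH h; apply: ler_sum => i _.
rewrite ler_wpM2l ?(p_valid h).1 //.
under eq_bigr do rewrite mulrDr; under [leRHS]eq_bigr do rewrite mulrDr.
rewrite !big_split /= lerD //; apply: ler_sum => x _.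
by rewrite ler_wpM2l.
Qed.

Lemma ev_sum (I : finType) (A : {set I}) (f : I -> 'I_K -> X -> R) h n :
  ev mu (fun i x => \sum_(k in A) f k i x) h n = \sum_(k in A) ev mu (f k) h n.
Proof.
elim: n h => [|n IH] h /=; first by rewrite big1.
rewrite exchange_big /=; apply: eq_bigr => i _; rewrite -mulr_sumr; congr (_ * _).
rewrite exchange_big /=; apply: eq_bigr => x _; rewrite -mulr_sumr; congr (_ * _).
by rewrite IH big_split.
Qed.

(** The expectation of [F] on an i.i.d. sample of length [n], as an iterated finite sum. *)
Fixpoint avg n (F : seq X -> R) : R :=
  match n with
  | 0 => F [::]
  | n'.+1 => \sum_x mu x * avg n' (fun s => F (x :: s))
  end.

Lemma avg_lin (I : finType) (c : I -> R) (F : I -> seq X -> R) n :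
  avg n (fun s => \sum_i c i * F i s) = \sum_i c i * avg n (F i).
Proof.
elim: n F => //= n IH F.
under eq_bigr do rewrite IH mulr_sumr.
rewrite exchange_big /=; apply: eq_bigr => i _; rewrite mulr_sumr.
by apply: eq_bigr => x _; rewrite mulrCA.
Qed.

Lemma avg_shift (c : R) F n : avg n (fun s => c + F s) = c + avg n F.
Proof.
elim: n F => //= n IH F; under eq_bigr do rewrite IH mulrDr.
by rewrite big_split /= -mulr_suml mu_sum mul1r.
Qed.

Lemma avg_sub F1 F2 n : avg n (fun s => F1 s - F2 s) = avg n F1 - avg n F2.
Proof.
elim: n F1 F2 => //= n IH F1 F2; rewrite -sumrB; apply: eq_bigr => x _.
by rewrite IH mulrBr.
Qed.

Lemma eq_avg F1 F2 n : F1 =1 F2 -> avg n F1 = avg n F2.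
Proof.
elim: n F1 F2 => //= n IH F1 F2 e; apply: eq_bigr => x _.
by congr (_ * _); apply: IH => s.
Qed.

Lemma avg_le_max F n : exists s, avg n F <= F s.
Proof.
elim: n F => [|n IH] F /=; first by exists [::].
have [x Hx] := weighted_max (fun x => avg n (fun s => F (x :: s))) mu_ge0 mu_sum.
by have [s Hs] := IH (fun s => F (x :: s)); exists (x :: s); exact: le_trans Hs.
Qed.

Lemma exp_loss_shift l h t n :
  exp_loss G p l h t.+1 n = exp_loss G p (fun s => l s.+1) h t n.
Proof. by elim: n h t => //= n IH h t; apply: eq_bigr => i _; rewrite IH. Qed.

Variable x0 : X.
(** The default [x0] prolongs a finite sample to a loss sequence defined at all rounds. *)
Let lseq (s : seq X) t i := loss (nth x0 s t) i.

Lemma avg_exp_loss h n :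
  avg n (fun s => exp_loss G p (lseq s) h 0 n) = ev mu (fun i x => loss x i) h n.
Proof.
elim: n h => //= n IH h.
transitivity (\sum_x mu x * \sum_i p h i *
    (loss x i + ev mu (fun i x => loss x i) (rcons h (sfeedback x i)) n)).
  apply: eq_bigr => x _; rewrite avg_lin; congr (_ * _); apply: eq_bigr => i _.
  rewrite -IH -avg_shift; congr (_ * _); apply: eq_avg => s.
  by rewrite exp_loss_shift.
under eq_bigr do rewrite mulr_sumr.
rewrite exchange_big /=; apply: eq_bigr => i _; rewrite mulr_sumr.
by apply: eq_bigr => x _; rewrite mulrCA.
Qed.

Lemma avg_cum_loss k n :
  avg n (fun s => cum_loss (lseq s) n k) = n%:R * \sum_x mu x * loss x k.
Proof.
elim: n => [|n IH] /=; first by rewrite /cum_loss big_ord0 mul0r.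
transitivity (\sum_x mu x * (loss x k + n%:R * \sum_x mu x * loss x k)).
  apply: eq_bigr => x _; rewrite -IH -avg_shift; congr (_ * _); apply: eq_avg => s.
  by rewrite /cum_loss big_ord_recl.
set m := \sum_x mu x * loss x k; under eq_bigr do rewrite mulrDr.
by rewrite big_split /= -mulr_suml mu_sum -natr1 -/m; ring.
Qed.

(** Some sample is at least as bad for the player as the average one. Comparing with a fixed [k]
    keeps the benchmark linear, so that it can be averaged. *)
Lemma derandomize T k : (forall x i, 0 <= loss x i <= 1) ->
  exists2 l, admissible_losses l & cum_loss l T k +
    (ev mu (fun i x => loss x i) [::] T - T%:R * \sum_x mu x * loss x k)
    <= exp_loss G p l [::] 0 T.
Proof.
move=> l01.
have [s] := avg_le_max (fun s => exp_loss G p (lseq s) [::] 0 T - cum_loss (lseq s) T k) T.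
rewrite avg_sub avg_exp_loss avg_cum_loss => H.
exists (lseq s) => [t i|]; first exact: l01.
lra.
Qed.
End Law.

(** * Change of measure from [mu0] to the tilted law [mu1] *)

Section ChangeOfMeasure.
Variables (mu0 r : X -> R) (kappa : R) (k : 'I_K) (T : nat).
Let mu1 x := mu0 x * r x.
Hypotheses (mu0_ge0 : forall x, 0 <= mu0 x) (mu0_sum : \sum_x mu0 x = 1).
Hypotheses (r_gt0 : forall x, 0 < r x) (mu1_sum : \sum_x mu1 x = 1).
(** One draw has Kullback-Leibler divergence of [mu0] from [mu1] at most [kappa]. *)
Hypothesis kappa_ln : - kappa <= \sum_x mu0 x * ln (r x).
Hypothesis unobserved : forall i (f : obs R K -> R), ~~ G i k ->
  \sum_x mu1 x * f (sfeedback x i) = \sum_x mu0 x * f (sfeedback x i).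
Hypothesis T_gt0 : (0 < T)%N.

Let mu1_ge0 x : 0 <= mu1 x.
Proof. by rewrite mulr_ge0 // ltW. Qed.

Let t : R := T%:R.
Let t_gt0 : 0 < t. Proof. by rewrite ltr0n. Qed.

Let info i (x : X) : R := (i != k)%:R / (3 * t) - kappa * (G i k)%:R.

(* A Donsker-Varadhan inequality for the number of rounds not spent on [k],
   with the exponential moment linearised on the fly. *)
Lemma change_of_measure_step n h (s : R) : 0 <= s -> s + n%:R <= t ->
  expR (s / (3 * t) + ev mu0 info h n) <=
  1 + 4 / 9 * ((s + ev mu1 (fun i _ => (i != k)%:R) h n) / t).
Proof.
elim: n h s => [|n IH] h s s0 sn.
  rewrite /= !addr0 in sn *.
  have st : s / t <= 1 by rewrite ler_pdivrMr // mul1r.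
  have st0 : 0 <= s / t by rewrite divr_ge0 // ltW.
  have e : s / (3 * t) = (s / t) / 3 by field; rewrite gt_eqF.
  (* For [x] in [[0, 1]], [expR (x / 3) <= 1 + x / 3 + x ^+ 2 / 9 <= 1 + 4 / 9 * x]. *)
  by rewrite e (le_trans (expR_le_quad _)) //; [lra|nra].
rewrite [ev mu0 _ _ _]/= [ev mu1 _ _ _]/=.
set S' := fun x i => ev mu0 info (rcons h (sfeedback x i)) n.
set Y' := fun x i => ev mu1 (fun i _ => (i != k)%:R) (rcons h (sfeedback x i)) n.
pose v i := s / (3 * t) + (i != k)%:R / (3 * t).
have -> : s / (3 * t) + (\sum_i p h i * (\sum_x mu0 x * (info i x + S' x i))) =
    \sum_i p h i * (v i - kappa * (G i k)%:R + \sum_x mu0 x * S' x i).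
  rewrite -[in LHS](round_const mu0_sum h (s / (3 * t))) -big_split /=.
  apply: eq_bigr => i _; rewrite -mulrDr; congr (_ * _).
  rewrite -[v i - _]mul1r -[X in X * (v i - _)]mu0_sum mulr_suml -!big_split /=.
  by apply: eq_bigr => x _; rewrite /info /v; ring.
have [p0 p1] := p_valid h.
apply: le_trans (expR_jensen _ p0 p1) _.
have -> : 1 + 4 / 9 * ((s + \sum_i p h i * (\sum_x mu1 x * ((i != k)%:R + Y' x i))) / t) =
    \sum_i p h i * (\sum_x mu1 x * (1 + 4 / 9 * ((s + (i != k)%:R + Y' x i) / t))).
  set E := \sum_i _; pose c := 1 + 4 / 9 * (s / t); pose d := 4 / 9 / t.
  transitivity (c + d * E); first by rewrite /c /d; ring.
  rewrite -{1}(round_const mu1_sum h c) mulr_sumr -big_split /=.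
  apply: eq_bigr => i _; rewrite [d * _]mulrCA -mulrDr; congr (_ * _).
  rewrite mulr_sumr -big_split /=.
  by apply: eq_bigr => x _; rewrite /c /d; ring.
apply: ler_sum => i _; rewrite ler_wpM2l //.
apply: (@le_trans _ _ (\sum_x mu1 x * expR (v i + S' x i))); last first.
  apply: ler_sum => x _; rewrite ler_wpM2l // /v -mulrDl IH //.
    by rewrite addr_ge0.
  have : (i != k)%:R <= 1 :> R by rewrite lern1 leq_b1.
  by move: sn; rewrite -natr1; lra.
(* An action revealing [k] pays [kappa], which covers the mean of [ln (r x)]; Jensen then turns
   [ln (r x)] into the density of [mu1]. For other actions the feedback has the same law under both
   measures. *)
have [Gik|Gik] := boolP (G i k).
  apply: (@le_trans _ _ (expR (\sum_x mu0 x * (v i + S' x i + ln (r x))))).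
    rewrite ler_expR mulr1.
    rewrite [leRHS](eq_bigr (fun x => mu0 x * v i + mu0 x * S' x i + mu0 x * ln (r x))).
      rewrite !big_split /= -mulr_suml mu0_sum mul1r.
      by have := kappa_ln; lra.
    by move=> x _; ring.
  apply: le_trans (expR_jensen _ mu0_ge0 mu0_sum) _.
  apply: ler_sum => x _; rewrite expRD lnK ?posrE // /mu1.
  by rewrite -mulrA [r x * _]mulrC.
rewrite mulr0 subr0 (unobserved (fun o => expR (v i + ev mu0 info (rcons h o) n)) Gik).
apply: le_trans (expR_jensen _ mu0_ge0 mu0_sum).
rewrite ler_expR; under [leRHS]eq_bigr do rewrite mulrDr.
by rewrite big_split /= -mulr_suml mu0_sum mul1r.
Qed.

(** The previous bound at [s = 0] and the empty history, with its left side linearised by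
    [1 + x <= expR x]. *)
Lemma change_of_measure :
  3 / 4 * ev mu0 (fun i _ => (i != k)%:R) [::] T -
    9 / 4 * t * kappa * ev mu0 (fun i _ => (G i k)%:R) [::] T <=
  ev mu1 (fun i _ => (i != k)%:R) [::] T.
Proof.
have := @change_of_measure_step T [::] 0 (lexx 0).
rewrite add0r mul0r add0r => /(_ (lexx _)).
set Y := ev mu1 _ _ _; set N := ev mu0 (fun i _ => (i != k)%:R) _ _; set I := ev mu0 (fun i _ => (G i k)%:R) _ _.
have -> : ev mu0 info [::] T = N / (3 * t) - kappa * I.
  rewrite /info -mulNr -(add0r (N / _)) [N / _]mulrC.
  rewrite -[0](_ : ev mu0 (fun _ _ => 0) [::] T = 0); last by rewrite ev_const // mulr0.
  rewrite -!ev_lin; congr (ev _ _ _ _); apply/funext => i; apply/funext => x.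
  ring.
move=> H; have {H} := le_trans (expR_ge1Dx _) H; rewrite lerD2l add0r => H.
have {H} := ler_wpM2l (mulr_ge0 (ler0n R 9) (ltW t_gt0)) H.
rewrite (_ : 9 * t * (4 / 9 * (Y / t)) = 4 * Y); last by field; rewrite gt_eqF.
rewrite (_ : 9 * t * (N / (3 * t) - kappa * I) = 3 * N - 9 * t * kappa * I); last first.
  by field; rewrite gt_eqF.
lra.
Qed.
End ChangeOfMeasure.
End StochasticGame.

(** * Fair-bit environments with one tilted bit *)

Section BitEnvironments.
Variables (R : realType) (K : nat).
Let X := {ffun 'I_K -> bool}.
Variables (a : 'I_K) (U : {set 'I_K}) (eps : R).
Hypotheses (aU : a \notin U) (eps_gt0 : 0 < eps) (eps_le : eps <= 8^-1).

Definition bit_loss (x : X) (i : 'I_K) : R :=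
  if i == a then 2^-1 - eps else if i \in U then (x i)%:R else 1.
Definition unif_law (_ : X) : R := #|X|%:R^-1.
Definition tilt (k : 'I_K) (x : X) : R := if x k then 1 - 4 * eps else 1 + 4 * eps.
Definition flip (k : 'I_K) (x : X) : X := [ffun j => if j == k then ~~ x j else x j].
Definition gap (i : 'I_K) : R :=
  if i == a then 0 else if i \in U then eps else 2^-1 + eps.

Lemma bit_loss01 x i : 0 <= bit_loss x i <= 1.
Proof.
have := eps_gt0; have := eps_le; rewrite /bit_loss.
by case: ifP => _; [|case: ifP => _; [case: (x i) => /=|]]; lra.
Qed.

Lemma unif_law_ge0 x : 0 <= unif_law x.
Proof. by rewrite invr_ge0. Qed.

Lemma unif_law_sum : \sum_x unif_law x = 1.
Proof.
rewrite sumr_const -[LHS]mulr_natl mulfV // pnatr_eq0 -lt0n.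
by apply/card_gt0P; exists [ffun=> true].
Qed.

Lemma flipK k : involutive (flip k).
Proof. by move=> x; apply/ffunP => j; rewrite !ffunE; case: eqP => // _; rewrite negbK. Qed.

Lemma flip_self k x : flip k x k = ~~ x k.
Proof. by rewrite ffunE eqxx. Qed.

(** Pairing [x] with [flip k x] reduces expectations over the cube to two-point identities. *)
Lemma sum_flip k (f : X -> R) :
  \sum_x unif_law x * f x = (\sum_x unif_law x * (f x + f (flip k x))) / 2.
Proof.
under [in RHS]eq_bigr do rewrite mulrDr.
rewrite big_split /= [X in _ + X](reindex_inj (inv_inj (flipK k))) /=.
by under [X in _ + X]eq_bigr do rewrite flipK; field.
Qed.

Lemma mean_of_flip k (f : X -> R) (c : R) : (forall x, f x + f (flip k x) = c) ->
  \sum_x unif_law x * f x = c / 2.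
Proof.
move=> fc; rewrite (sum_flip k); under eq_bigr do rewrite fc.
by rewrite -mulr_suml unif_law_sum mul1r.
Qed.

Lemma tilt_gt0 k x : 0 < tilt k x.
Proof. by rewrite /tilt; have := eps_gt0; have := eps_le; case: (x k); lra. Qed.

Lemma tilt_mean k : \sum_x unif_law x * tilt k x = 1.
Proof.
rewrite (@mean_of_flip k _ 2) ?divff // => x.
by rewrite /tilt flip_self; case: (x k) => /=; ring.
Qed.

Lemma tilt_invariant k (f : X -> R) : (forall x, f (flip k x) = f x) ->
  \sum_x unif_law x * tilt k x * f x = \sum_x unif_law x * f x.
Proof.
move=> fk; under eq_bigr do rewrite -mulrA.
rewrite [LHS](sum_flip k); rewrite [X in X / 2](eq_bigr (fun x => (unif_law x * f x) * 2)).
  by rewrite -mulr_suml mulfK ?pnatr_eq0.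
by move=> x _; rewrite fk /tilt flip_self; case: (x k) => /=; ring.
Qed.

(** The two values of [ln (tilt k x)] add up to [ln (1 - z)] with [z = 16 * eps ^+ 2 <= 1 / 2], and
    [ln (1 - z) >= - (2 * z)]. *)
Lemma tilt_ln k : - (16 * eps ^+ 2) <= \sum_x unif_law x * ln (tilt k x).
Proof.
have e0 := eps_gt0; have e8 := eps_le.
rewrite (@mean_of_flip k _ (ln (1 - 16 * eps ^+ 2))); last first.
  move=> x; rewrite -lnM ?posrE ?tilt_gt0 // /tilt flip_self; congr ln.
  by case: (x k) => /=; ring.
have z : 16 * eps ^+ 2 <= 2^-1 by nra.
have p0 : 0 < 1 - 16 * eps ^+ 2 by lra.
have := ln_ge1BV p0; suff : - (2 * (16 * eps ^+ 2)) <= 1 - (1 - 16 * eps ^+ 2)^-1 by lra.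
rewrite -(ler_pM2r p0) mulrBl mulVf ?gt_eqF //; have := sqr_ge0 eps; nra.
Qed.

Lemma neq_safe i : i \in U -> (i == a) = false.
Proof. by apply: contraTF => /eqP ->. Qed.

Lemma bit_mean i : i \in U -> \sum_x unif_law x * bit_loss x i = 2^-1.
Proof.
move=> iU; have ia : (i == a) = false by exact: neq_safe.
rewrite (@mean_of_flip i _ 1) ?mul1r // => x.
by rewrite /bit_loss ia iU flip_self; case: (x i) => /=; ring.
Qed.

Lemma loss_mean_unif i :
  \sum_x unif_law x * bit_loss x i = 2^-1 - eps + gap i.
Proof.
rewrite /gap; case: (eqVneq i a) => [->|ia].
  under eq_bigr do rewrite /bit_loss eqxx.
  by rewrite -mulr_suml unif_law_sum; ring.
have [iU|iU] := boolP (i \in U); first by rewrite bit_mean //; ring.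
under eq_bigr do rewrite /bit_loss (negPf ia) (negPf iU).
by rewrite -mulr_suml unif_law_sum; field.
Qed.

Lemma loss_mean_tilt_self k : k \in U ->
  \sum_x unif_law x * tilt k x * bit_loss x k = 2^-1 - 2 * eps.
Proof.
move=> kU; have ka : (k == a) = false by exact: neq_safe.
under eq_bigr do rewrite -mulrA.
rewrite (@mean_of_flip k _ (1 - 4 * eps)); first by field.
by move=> x; rewrite /bit_loss ka kU /tilt flip_self; case: (x k) => /=; ring.
Qed.

Lemma loss_mean_tilt k i : k \in U ->
  2^-1 - 2 * eps + eps * (i != k)%:R <= \sum_x unif_law x * tilt k x * bit_loss x i.
Proof.
move=> kU; have e0 := eps_gt0.
case: (eqVneq i k) => [->|ik] /=.
  by rewrite loss_mean_tilt_self // mulr0 addr0.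
rewrite tilt_invariant ?loss_mean_unif.
  by rewrite /gap; case: ifP => _; [|case: ifP => _]; lra.
by move=> x; rewrite /bit_loss ffunE (negPf ik).
Qed.

Variables (G : rel 'I_K) (T : nat) (A B : R).
Hypotheses (T_gt0 : (0 < T)%N) (U_gt0 : (0 < #|U|)%N) (B_ge0 : 0 <= B).
(** [A] counts the observations of [U] that a round gives for free; further ones are bought with
    regret, at most [B] per unit. *)
Hypothesis observers : forall i, (\sum_(k in U) (G i k)%:R) <= A + B * gap i.
Hypothesis eps_small : 128 * eps ^+ 2 * T%:R * (A + B * eps / 4) <= #|U|%:R.

(* Either the player pays [eps T / 4] under the uniform law, or it explores so
   little that for some [k] in [U] it cannot detect that [k] has become the
   best action. *)
Lemma lower_bound_game : eps * T%:R / 4 <= minimax_regret R G T.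
Proof.
have K0 : (0 < K)%N by exact: leq_ltn_trans (ltn_ord a).
apply: minimax_regret_ge => // p vp.
have e0 := eps_gt0; have t0 : 0 < T%:R :> R by rewrite ltr0n.
pose x0 : X := [ffun=> true].
have u0 := unif_law_ge0; have u1 := unif_law_sum.
have [l al Hl] := derandomize G p u0 u1 x0 T a bit_loss01.
set E := ev G bit_loss p unif_law _ _ _ in Hl.
have [big|small] := leP (eps * T%:R / 4) (E - T%:R * \sum_x unif_law x * bit_loss x a).
  by exists l => //; exists a; apply: le_trans Hl; rewrite lerD2l.
pose Eg := ev G bit_loss p unif_law (fun i _ => gap i) [::] T.
have HEg : Eg <= eps * T%:R / 4.
  apply: le_trans (ltW small).
  rewrite loss_mean_unif /gap eqxx addr0.
  suff : T%:R * (2^-1 - eps) + 1 * Eg <= E by lra.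
  rewrite -(ev_const G bit_loss vp u1 (2^-1 - eps) [::] T) -ev_lin.
  apply: ev_mono => // i; rewrite loss_mean_unif -mulr_suml u1; lra.
pose Ik k := ev G bit_loss p unif_law (fun i _ => (G i k)%:R) [::] T.
have sumI : \sum_(k in U) Ik k <= T%:R * (A + B * eps / 4).
  rewrite -ev_sum; apply: (@le_trans _ _ (T%:R * A + B * Eg)).
    rewrite -(ev_const G bit_loss vp u1 A [::] T) -ev_lin.
    apply: ev_mono => // i; rewrite -!mulr_suml u1 !mul1r; exact: observers.
  have := ler_wpM2l B_ge0 HEg; lra.
(* Pigeonhole: by [eps_small] the expected observation counts [Ik k] are at most
   [(128 * eps ^+ 2)^-1] on average over [U]. *)
have [k kU Hk] : exists2 k, k \in U & 128 * eps ^+ 2 * Ik k <= 1.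
  have [/exists_inP[k kU Hk]|/exists_inPn none] :=
    boolP [exists k in U, 128 * eps ^+ 2 * Ik k <= 1]; first by exists k.
  have /card_gt0P[k kU] := U_gt0.
  have : #|U|%:R < \sum_(k in U) 128 * eps ^+ 2 * Ik k.
    rewrite -sumr_const (bigD1 k) //= [ltRHS](bigD1 k) //=; apply: ltr_leD.
      by rewrite ltNge none.
    by apply: ler_sum => j /andP[jU _]; rewrite leNgt; apply/negP => /ltW; apply/negP/none.
  rewrite -mulr_sumr => /lt_le_trans/(_ (ler_wpM2l _ sumI)).
  have e2 : 0 <= 128 * eps ^+ 2 by rewrite mulr_ge0 // sqr_ge0.
  by move=> /(_ e2)/lt_le_trans; rewrite mulrA => /(_ _ eps_small); rewrite ltxx.
pose mu1 x := unif_law x * tilt k x.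
have m0 x : 0 <= mu1 x by rewrite mulr_ge0 // ltW // tilt_gt0.
have m1 : \sum_x mu1 x = 1 by exact: tilt_mean.
have [l' al' Hl'] := derandomize G p m0 m1 x0 T k bit_loss01.
exists l' => //; exists k; apply: le_trans Hl'; rewrite lerD2l.
rewrite loss_mean_tilt_self //.
set Y := ev G bit_loss p mu1 (fun i _ => (i != k)%:R) [::] T.
apply: (@le_trans _ _ (eps * Y)); last first.
  suff : T%:R * (2^-1 - 2 * eps) + eps * Y <= ev G bit_loss p mu1 (fun i x => bit_loss x i) [::] T by lra.
  rewrite -(ev_const G bit_loss vp m1 (2^-1 - 2 * eps) [::] T) -ev_lin.
  by apply: ev_mono => // i; rewrite -mulr_suml m1 mul1r; exact: loss_mean_tilt.
have unobs i (f : obs R K -> R) : ~~ G i k ->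
    \sum_x mu1 x * f (sfeedback G bit_loss x i) = \sum_x unif_law x * f (sfeedback G bit_loss x i).
  move=> Gik; apply: tilt_invariant => x; congr (f (_, _)); apply/funext => j.
  case: ifP => // Gij; rewrite /bit_loss ffunE; case: (eqVneq j k) => // jk.
  by rewrite jk (negPf Gik) in Gij.
have := change_of_measure vp u0 u1 (tilt_gt0 k) m1 (tilt_ln k) unobs T_gt0.
rewrite -/Y -/(Ik k); set N := ev _ _ _ _ _ _ _ => HY.
(* Every round spent on [k] costs [eps] under the uniform law. *)
have HN : T%:R - eps^-1 * Eg <= N.
  rewrite -[T%:R]mulr1 -(ev_const G bit_loss vp u1 1 [::] T) -mulNr -ev_lin.
  apply: ev_mono => // i; apply: ler_sum => x _; rewrite ler_wpM2l // mulNr.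
  case: (eqVneq i k) => [->|ik] /=.
    have ka : (k == a) = false by exact: neq_safe.
    by rewrite /gap ka kU mulVf ?gt_eqF // subrr.
  rewrite gerBl mulr_ge0 ?invr_ge0 ?(ltW e0) // /gap.
  by case: ifP => // _; case: ifP => _; lra.
have HN' : 3 / 4 * T%:R <= N.
  suff : eps^-1 * Eg <= T%:R / 4 by lra.
  by rewrite mulrC ler_pdivrMr // (le_trans HEg) //; lra.
have HI : 128 * (T%:R * eps ^+ 2 * Ik k) <= T%:R.
  by have := ler_wpM2l (ltW t0) Hk; lra.
(* With [kappa = 16 * eps ^+ 2], the change of measure leaves at least [9 / 16 - 36 / 128 = 9 / 32]
   of the rounds. *)
have : T%:R / 4 <= Y by lra.
by move=> /(ler_wpM2l (ltW e0)); lra.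
Qed.
End BitEnvironments.

(** * Lower bounds *)

Section LowerBounds.
Variables (R : realType) (K : nat) (G : rel 'I_K) (T : nat).
Hypotheses (K_ge2 : (2 <= K)%N) (KT : (K ^ 3 <= T)%N).

Let K_gt0 : (0 < K)%N. Proof. exact: ltnW. Qed.

Let T_ge_K : (K <= T)%N.
Proof. by apply: leq_trans KT; rewrite -{1}(expn1 K) leq_pexp2l. Qed.

Let T_gt0 : (0 < T)%N. Proof. exact: leq_trans T_ge_K. Qed.

Let t : R := T%:R.
Let t_gt0 : 0 < t. Proof. by rewrite ltr0n. Qed.

Lemma sqrt_lower : Num.sqrt t / 48 <= minimax_regret R G T.
Proof.
pose a := Ordinal K_gt0; pose b := Ordinal K_ge2.
set s := Num.sqrt t; have s1 : 1 <= s by rewrite -sqrtr1 ler_wsqrtr // ler1n.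
have s0 : 0 < s by exact: lt_le_trans s1.
have ss : s ^+ 2 = t by rewrite sqr_sqrtr // ltW.
pose eps := (12 * s)^-1.
have e0 : 0 < eps by rewrite invr_gt0 mulr_gt0.
have e8 : eps <= 8^-1 by rewrite lef_pV2 ?posrE ?mulr_gt0 //; lra.
have H := @lower_bound_game R K a [set b] eps _ e0 e8 G T 1 0 T_gt0.
apply: le_trans (H _ _ _ _ _); rewrite ?cards1 ?inE //.
- rewrite le_eqVlt; apply/orP; left; apply/eqP; rewrite -/t -ss /eps.
  by field; rewrite gt_eqF.
- by move=> i; rewrite big_set1 mul0r addr0 lern1 leq_b1.
- rewrite !mul0r addr0 mulr1 -/t -ss /eps.
  rewrite (_ : _ * _ = 128 / 144); first by lra.
  by field; rewrite gt_eqF.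
Qed.

(** [a] reveals nothing in [U]; a member of [U] reveals at most itself at cost [eps]; any other
    action reveals at most [n] members at cost at least [1 / 2]. Hence [B = eps^-1 + 2 * n]. *)
Lemma independent_lower (a : 'I_K) (U : {set 'I_K}) : a \notin U -> (0 < #|U|)%N ->
  independent G (a |: U) ->
  Num.sqrt (#|U|%:R * t) / 48 <= minimax_regret R G T.
Proof.
move=> aU U0 ind.
have nedge i k : i \in a |: U -> k \in U -> i != k -> ~~ G i k.
  move=> iU kU; have /forall_inP/(_ i iU)/forall_inP := ind.
  by move=> /(_ k); rewrite in_setU1 kU orbT => /(_ isT)/implyP.
set n : R := #|U|%:R.
have n0 : 0 < n by rewrite ltr0n.
have n1 : 1 <= n by rewrite ler1n.
pose z := Num.sqrt (n / t).
have z0 : 0 < z by rewrite sqrtr_gt0 divr_gt0.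
have zt : z ^+ 2 * t = n by rewrite sqr_sqrtr ?divfK ?gt_eqF // divr_ge0 // ltW.
have nK3 : n ^+ 3 <= t.
  rewrite -natrX ler_nat (leq_trans _ KT) // leq_exp2r //.
  by rewrite -[leqRHS]card_ord max_card.
have zn : z * n <= 1.
  (* The square of [z * n] is [n ^+ 3 / t]; here [T >= K ^ 3] keeps the term [2 * n] of [B]
     harmless. *)
  rewrite -(ler_pXn2r (n := 2)) ?nnegrE ?mulr_ge0 ?(ltW z0) ?(ltW n0) // expr1n exprMn.
  rewrite -(ler_pM2l t_gt0) mulr1 mulrA [t * _]mulrC zt -exprS.
  exact: nK3.
have z1 : z <= 1 by nra.
pose eps := z / 12.
have e0 : 0 < eps by rewrite divr_gt0.
have e8 : eps <= 8^-1 by rewrite /eps; lra.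
have H := @lower_bound_game R K a U eps aU e0 e8 G T 0 (eps^-1 + 2 * n) T_gt0 U0.
apply: le_trans (H _ _ _).
- rewrite le_eqVlt; apply/orP; left; apply/eqP; rewrite -/t.
  have -> : n * t = (z * t) ^+ 2 by rewrite -zt; ring.
  by rewrite sqrtr_sqr ger0_norm ?mulr_ge0 ?ltW // /eps; field.
- by rewrite addr_ge0 ?invr_ge0 ?mulr_ge0 // ltW.
- move=> i; rewrite add0r /gap; have [->|ia] := eqVneq i a.
    rewrite mulr0 big1 // => k kU.
    rewrite (negPf (nedge _ _ _ kU _)) ?in_setU1 ?eqxx //.
    by apply: contraNneq aU => ->.
  case: ifP => iU.
    rewrite mulrDl mulVf ?gt_eqF // (bigD1 i) //= big1 => [|k /andP[kU ki]].
      by rewrite addr0 (@le_trans _ _ 1) ?lern1 ?leq_b1 // lerDl mulr_ge0 ?mulr_ge0 // ltW.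
    by rewrite (negPf (nedge _ _ _ kU _)) ?in_setU1 ?iU ?orbT // eq_sym.
  apply: (@le_trans _ _ n).
    rewrite /n -sumr_const; apply: ler_sum => k _; by rewrite lern1 leq_b1.
  have : 0 < eps^-1 by rewrite invr_gt0.
  have := e0; nra.
- rewrite add0r -/t -/n.
  have -> : 128 * eps ^+ 2 * t * ((eps^-1 + 2 * n) * eps / 4) =
     n * (32 / 144 + 64 / 1728 * (z * n)).
    rewrite -[X in _ = X * _]zt /eps; field; rewrite gt_eqF //.
  have c1 : 32 / 144 + 64 / 1728 * (z * n) <= 1 by lra.
  by have := ler_wpM2l (ltW n0) c1; rewrite mulr1.
Qed.

(** Reserving one vertex of a largest independent set as the safe action at most halves its size;
    [sqrt_lower] covers size [1]. *)
Lemma strong_lower :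
  Num.sqrt ((independence_number G)%:R * t) / 96 <= minimax_regret R G T.
Proof.
have [S indS HS] : exists2 S, independent G S & independence_number G = #|S|.
  rewrite /independence_number.
  have [|S Si ->] := @eq_bigmax_cond _ (independent G) (fun S => #|S|).
    by apply/card_gt0P; exists set0; exact: independent0.
  by exists S.
rewrite HS; have S0 : (0 < #|S|)%N by rewrite -HS independence_number_gt0.
have [S1|S1] := leqP #|S| 1.
  apply: le_trans sqrt_lower; rewrite (_ : #|S| = 1%N) ?mul1r.
    by have := sqrtr_ge0 t; lra.
  by apply/eqP; rewrite eqn_leq S1.
have /card_gt0P[a aS] := S0.
have cS := cardsD1 a S; rewrite aS add1n in cS.
have := @independent_lower a (S :\ a); rewrite setD11 setD1K // => /(_ isT) H.
have U0 : (0 < #|S :\ a|)%N by rewrite -ltnS -cS.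
apply: le_trans (H U0 indS).
set n : R := #|S :\ a|%:R; have n1 : 1 <= n by rewrite ler1n.
have : Num.sqrt (#|S|%:R * t) <= 2 * Num.sqrt (n * t).
  rewrite -[2]ger0_norm // -sqrtr_sqr -sqrtrM ?sqr_ge0 // ler_wsqrtr //.
  rewrite cS -natr1 -/n mulrA ler_pM2r //; lra.
lra.
Qed.

Let cuberoot x : R := powR x (1 / 3).

Lemma cuberootK x : 0 < x -> cuberoot x ^+ 3 = x.
Proof.
move=> x0; rewrite -powR_mulrn ?powR_ge0 // -powRrM.
by rewrite (_ : 1 / 3 * 3%:R = 1) ?powRr1 ?ltW //; field.
Qed.

(** Neither [a] nor [U] reveals any member of [U], so information comes only from actions with gap
    at least [1 / 2], each revealing at most [L] members: [A = 0] and [B = 2 * L]. Then [eps] of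
    order [(n / (L * t)) ^ (1/3)] is allowed. *)
Lemma dominated_lower (a : 'I_K) (U : {set 'I_K}) (L : R) : a \notin U ->
  (0 < #|U|)%N -> (forall i k, i \in a |: U -> k \in U -> ~~ G i k) -> 1 <= L ->
  (forall i, \sum_(k in U) (G i k)%:R <= L) ->
  cuberoot (#|U|%:R / L) * powR t (2 / 3) / 32 <= minimax_regret R G T.
Proof.
move=> aU U0 nedge L1 HL; set n : R := #|U|%:R.
have n0 : 0 < n by rewrite ltr0n.
have L0 : 0 < L by exact: lt_le_trans L1.
pose z := cuberoot (n / L); pose y := cuberoot t.
have z0 : 0 < z by rewrite powR_gt0 // divr_gt0.
have y0 : 0 < y by rewrite powR_gt0.
have z3 : z ^+ 3 = n / L by rewrite cuberootK // divr_gt0.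
have y3 : y ^+ 3 = t by rewrite cuberootK.
have zy : z <= y.
  rewrite -(ler_pXn2r (n := 3)) ?nnegrE ?(ltW z0) ?(ltW y0) // z3 y3.
  rewrite ler_pdivrMr // (@le_trans _ _ (t * 1)) ?ler_pM2l // mulr1.
  by rewrite ler_nat (leq_trans _ T_ge_K) // -[leqRHS]card_ord max_card.
have -> : powR t (2 / 3) = y ^+ 2.
  by rewrite -powR_mulrn ?powR_ge0 // -powRrM; congr powR; field.
rewrite -/z; pose eps := z / y / 8.
have e0 : 0 < eps by rewrite !divr_gt0.
have e8 : eps <= 8^-1 by rewrite -[leRHS]mul1r ler_pM2r // ler_pdivrMr // mul1r.
have H := @lower_bound_game R K a U eps aU e0 e8 G T 0 (2 * L) T_gt0 U0.
apply: le_trans (H _ _ _).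
- rewrite le_eqVlt; apply/orP; left; apply/eqP; rewrite -/t -y3 /eps.
  by field; rewrite gt_eqF.
- by rewrite mulr_ge0 // ltW.
- move=> i; rewrite add0r /gap; have [->|ia] := eqVneq i a.
    rewrite mulr0 big1 // => k kU.
    by rewrite (negPf (nedge _ _ _ kU)) ?in_setU1 ?eqxx.
  case: ifP => iU.
    rewrite big1 => [|k kU]; first by rewrite pmulr_lge0 // mulr_ge0 // ltW.
    by rewrite (negPf (nedge _ _ _ kU)) ?in_setU1 ?iU ?orbT.
  by apply: (le_trans (HL i)); have := e0; nra.
- rewrite add0r -/t -/n.
  have -> : 128 * eps ^+ 2 * t * (2 * L * eps / 4) = n / 8.
    rewrite -y3 /eps (_ : n = z ^+ 3 * L); last by rewrite z3 divfK ?gt_eqF.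
    by field; rewrite gt_eqF.
  lra.
Qed.

(** Two environments differ only in the loss of an unobservable [w], [0] or [1], the others losing
    [1 / 2]. The player behaves alike in both and its two expected losses add up to [T], so it does
    badly in one of them. *)
Lemma unobservable_lower : ~~ observable G -> t / 4 <= minimax_regret R G T.
Proof.
move=> /forallPn[w /existsPn Hw].
pose lb (b : R) (_ : nat) (i : 'I_K) : R := if i == w then b else 2^-1.
have adm b : 0 <= b <= 1 -> admissible_losses (lb b).
  by move=> b01 s i; rewrite /lb; case: ifP => // _; lra.
have [k kw] : exists k, k != w.
  case: (eqVneq w (Ordinal K_gt0)) => [->|]; last by rewrite eq_sym; exists (Ordinal K_gt0).
  by exists (Ordinal K_ge2).
apply: minimax_regret_ge => // p vp.
have sum_const h n s : exp_loss G p (lb 0) h s n + exp_loss G p (lb 1) h s n = n%:R.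
  elim: n h s => [|n IH] h s /=; first by rewrite addr0.
  rewrite -big_split /= -[RHS]mul1r -[X in X * _](vp h).2 mulr_suml.
  apply: eq_bigr => i _; rewrite -mulrDr; congr (_ * _).
  have -> : feedback G (lb 1) s i = feedback G (lb 0) s i.
    congr (_, _); apply/funext => j; case: ifP => // Gij; rewrite /lb.
    by case: eqVneq => // jw; have := Hw i; rewrite -jw Gij.
  rewrite -natr1 -(IH (rcons h (feedback G (lb 0) s i)) s.+1) /lb.
  by case: ifP => _; field.
have := sum_const [::] T 0%N.
have [big|small] := leP (t / 4) (exp_loss G p (lb 0) [::] 0 T).
  exists (lb 0); first by apply: adm; rewrite lexx ler01.
  exists w; rewrite /cum_loss big1 ?add0r // => s _.
  by rewrite /lb eqxx.
rewrite -/t => tot; exists (lb 1); first by apply: adm; rewrite lexx ler01.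
exists k; rewrite /cum_loss (eq_bigr (fun=> 2^-1)); last by move=> s _; rewrite /lb (negPf kw).
rewrite sumr_const card_ord -[_ *+ T]mulr_natl -/t; lra.
Qed.
End LowerBounds.

(** * Weak domination *)

Section WeakDominationCore.
Variables (R : realType) (K : nat) (G : rel 'I_K).
Hypothesis K_gt0 : (0 < K)%N.
Let W := [set w | weakly_observable_vertex G w].
Let dominated v (A : {set 'I_K}) := [set w in A | G v w].

Lemma weak_no_loop w : w \in W -> ~~ G w w.
Proof. by rewrite inE => /andP[_]; rewrite negb_or => /andP[]. Qed.

(** Each step adds a vertex dominating more than a fraction [1 / d] of what is still uncovered. *)
Lemma greedy_cover (d : R) : 1 <= d ->
  (forall A : {set 'I_K}, A \subset W -> A != set0 -> exists v, #|A|%:R < d * #|dominated v A|%:R) ->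
  forall n, exists2 D : {set 'I_K}, (#|D| <= n)%N &
    #|[set w in W | ~~ [exists v in D, G v w]]|%:R <= K%:R * (1 - d^-1) ^+ n.
Proof.
move=> d1 H; have d0 : 0 < d by exact: lt_le_trans d1.
have r0 : 0 <= 1 - d^-1 by rewrite subr_ge0 invf_le1.
elim=> [|n [D cD HD]].
  exists set0; rewrite ?cards0 // expr0 mulr1 ler_nat.
  by rewrite -[leqRHS]card_ord max_card.
set A := [set w in W | _] in HD.
have [A0|An0] := eqVneq A set0.
  exists D; first exact: ltnW.
  by rewrite -/A A0 cards0 mulr_ge0 ?exprn_ge0.
have AW : A \subset W by apply/subsetP => w; rewrite inE => /andP[].
have [v Hv] := H A AW An0.
exists (v |: D).
  by rewrite cardsU1; case: (v \notin D); rewrite ?add0n ?add1n // ltnW.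
apply: (@le_trans _ _ (#|A|%:R * (1 - d^-1))); last first.
  by rewrite exprSr mulrA ler_wpM2r.
have cA : (#|[set w in W | ~~ [exists v0 in v |: D, G v0 w]]| <= #|A| - #|dominated v A|)%N.
  have sub : dominated v A \subset A by apply/subsetP => w; rewrite inE => /andP[].
  rewrite -(setIidPr sub) -cardsD; apply: subset_leq_card; apply/subsetP => w.
  rewrite !inE => /andP[-> /= no].
  have nv : ~~ G v w.
    by apply: contra no => Gvw; apply/exists_inP; exists v => //; rewrite setU11.
  rewrite (negPf nv) andbF /=.
  apply: contra no => /exists_inP[u uD Guw]; apply/exists_inP; exists u => //.
  by rewrite in_setU1 uD orbT.
have dA : (#|dominated v A| <= #|A|)%N.
  by apply: subset_leq_card; apply/subsetP => w; rewrite inE => /andP[].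
apply: (@le_trans _ _ (#|A|%:R - #|dominated v A|%:R)); first by rewrite -natrB // ler_nat.
rewrite mulrBr mulr1 lerD2l lerN2 ler_pdivrMr //.
by rewrite mulrC ltW.
Qed.

(** Otherwise the greedy cover never gets stuck, and after [n > d * ln K] steps fewer than one
    vertex is uncovered, giving a dominating set smaller than the minimum. *)
Lemma hard_core (d : R) : 1 <= d ->
  d * ln K%:R + 1 < (weak_domination_number G)%:R ->
  exists A : {set 'I_K}, [/\ A \subset W, A != set0 &
    forall v, d * #|dominated v A|%:R <= #|A|%:R].
Proof.
move=> d1 small; have d0 : 0 < d by exact: lt_le_trans d1.
have K0 : 0 < K%:R :> R by rewrite ltr0n.
apply: contrapT => none.
have H (A : {set 'I_K}) : A \subset W -> A != set0 -> exists v, #|A|%:R < d * #|dominated v A|%:R.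
  move=> AW An0; apply: contrapT => nov; apply: none; exists A; split => // v.
  by rewrite leNgt; apply/negP => lt; apply: nov; exists v.
pose n := (Num.truncn (d * ln K%:R)).+1.
have l0 : 0 <= d * ln K%:R by rewrite mulr_ge0 ?(ltW d0) // ln_ge0 // ler1n.
have /andP[n1 n2] := Num.Theory.truncn_itv l0.
have [D cD] := greedy_cover d1 H n.
set E := [set w in W | _] => HE.
have E0 : E = set0.
  apply/eqP; rewrite -cards_eq0 -leqn0 -ltnS -(ltr_nat R).
  apply: le_lt_trans HE _.
  have : 1 - d^-1 <= expR (- d^-1) by exact: expR_ge1Dx.
  have r0 : 0 <= 1 - d^-1 by rewrite subr_ge0 invf_le1.
  move=> /(lerXn2r n r0 (expR_ge0 _)) Hn.
  apply: (@le_lt_trans _ _ (K%:R * expR (- d^-1) ^+ n)).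
    by rewrite ler_wpM2l // ltW.
  rewrite -{1}(lnK K0) -expRM_natl -expRD expR_lt1 mulrN subr_lt0.
  by rewrite ltr_pdivlMr // mulrC.
have domD : weakly_dominating G D.
  apply/forallP => w; apply/implyP => ww; apply: contraT => no.
  suff : w \in E by rewrite E0 inE.
  by rewrite !inE ww.
have : (weak_domination_number G)%:R <= n%:R :> R.
  by rewrite ler_nat (leq_trans _ cD) // weak_domination_number_le.
by rewrite /n -natr1; lra.
Qed.

(* Derandomised sampling: the points are chosen one at a time so as to keep
   [\sum_v 2 ^ (number of chosen points dominated by v)] below its mean. *)
Lemma sample_core (d : R) (A : {set 'I_K}) : 0 < d -> A != set0 ->
  (forall v, d * #|dominated v A|%:R <= #|A|%:R) ->
  forall n, exists s : seq 'I_K, [/\ size s = n, {subset s <= A} &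
    \sum_v 2 ^+ count (G v) s <= K%:R * (1 + d^-1) ^+ n].
Proof.
move=> d0 An0 HA; have A0 : 0 < #|A|%:R :> R by rewrite ltr0n card_gt0.
elim=> [|n [s [ss sA Hs]]].
  exists [::]; split => //; rewrite expr0 mulr1 (eq_bigr (fun=> 1)) //.
  by rewrite sumr_const card_ord.
pose Phi w : R := \sum_v 2 ^+ count (G v) (w :: s).
have mean : \sum_(w in A) Phi w <= #|A|%:R * (K%:R * (1 + d^-1) ^+ n.+1).
  rewrite exchange_big /=.
  apply: (@le_trans _ _ (\sum_v (2 ^+ count (G v) s * (#|A|%:R * (1 + d^-1))))); last first.
    rewrite -mulr_suml exprSr.
    rewrite [leRHS](_ : _ = K%:R * (1 + d^-1) ^+ n * (#|A|%:R * (1 + d^-1))); last by ring.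
    by rewrite ler_wpM2r // mulr_ge0 ?addr_ge0 ?invr_ge0 // ltW.
  apply: ler_sum => v _.
  (* A new point [w] doubles the term of [v] exactly when [v] dominates [w], so averaging over [A]
     multiplies it by at most [1 + d^-1]. *)
  have -> : \sum_(w in A) 2 ^+ (G v w + count (G v) s) =
      2 ^+ count (G v) s * (#|A|%:R + #|dominated v A|%:R) :> R.
    rewrite -!sumr_const mulrDr !mulr_sumr.
    rewrite [X in _ = _ + X](eq_bigl (fun w => (w \in A) && G v w)); last by move=> w; rewrite inE.
    rewrite [X in _ = _ + X]big_mkcondr -big_split /=; apply: eq_bigr => w _.
    by rewrite exprD; case: (G v w); rewrite /= ?expr1 ?expr0; ring.
  rewrite ler_pM2l ?exprn_gt0 // mulrDr mulr1 lerD2l ler_pdivlMr // mulrC.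
  exact: HA.
have [w wA Hw] : exists2 w, w \in A & Phi w <= K%:R * (1 + d^-1) ^+ n.+1.
  have [/exists_inP[w wA Hw]|/exists_inPn none] :=
    boolP [exists w in A, Phi w <= K%:R * (1 + d^-1) ^+ n.+1]; first by exists w.
  have /set0Pn[w wA] := An0.
  move: mean; rewrite leNgt => /negP[]; rewrite mulr_natl -sumr_const.
  rewrite (bigD1 w) // [ltRHS](bigD1 w) //=; apply: ltr_leD; first by rewrite ltNge none.
  by apply: ler_sum => j /andP[jA _]; rewrite leNgt; apply/negP => /ltW; apply/negP/none.
exists (w :: s); split => //=; first by rewrite ss.
by move=> u; rewrite inE => /predU1P[->//|]; exact: sA.
Qed.

Lemma sum_count_mem (I : finType) (A : {set I}) (s : seq I) :
  (\sum_(w in A) count_mem w s)%N = count (mem A) s.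
Proof.
elim: s => [|x s IH] /=; first by rewrite big1.
rewrite big_split /= IH; congr (_ + _)%N; rewrite big_mkcond (bigD1 x) //= eqxx big1.
  by rewrite addn0; case: (x \in A).
by move=> i /negPf ix; rewrite eq_sym ix; case: ifP.
Qed.

Lemma card_filter_le (s : seq 'I_K) (P : pred 'I_K) :
  (#|[set w in s | P w]| <= count P s)%N.
Proof.
rewrite -size_filter; apply: leq_trans (card_size _); apply: subset_leq_card.
by apply/subsetP => w; rewrite !inE mem_filter andbC.
Qed.

(* A seq of weakly observable vertices where every vertex dominates few
   entries has few repetitions, and few edges between its entries. *)
Lemma sparse_independent (s : seq 'I_K) (L : R) : 0 <= L -> {subset s <= W} ->
  (forall v, (count (G v) s)%:R <= L) ->
  exists S : {set 'I_K}, [/\ {subset S <= s}, independent G S &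
    (size s)%:R <= L * (1 + 2 * L) * #|S|%:R].
Proof.
move=> L0 sW HL; pose U := [set w in s].
have HU v : #|[set w in U | G v w]|%:R <= L.
  apply: le_trans (HL v); rewrite ler_nat; apply: leq_trans (card_filter_le _ _).
  by apply: subset_leq_card; apply/subsetP => w; rewrite !inE.
have szU : (size s)%:R <= L * #|U|%:R.
  have -> : (size s)%:R = \sum_(w in U) (count_mem w s)%:R :> R.
    rewrite -natr_sum sum_count_mem; congr _%:R; apply/esym/eqP.
    by rewrite -all_count; apply/allP => w ws; rewrite -[mem U w]/(w \in U) inE.
  rewrite mulr_natr -sumr_const; apply: ler_sum => w; rewrite inE => ws.
  (* Some [v] dominates [w], hence all its copies in [s], so the multiplicity of [w] is at most
     [L]. *)
  have := sW w ws; rewrite inE => /andP[/existsP[v Gvw] _].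
  apply: le_trans (HL v); rewrite ler_nat; apply: sub_count => u /eqP -> //.
have p1 (i : 'I_K) : i \in U -> 0 < (fun=> 1 : R) i by [].
have [S [SU Sind HS]] := caro_wei G p1.
exists S; split => //; first by move=> w /(subsetP SU); rewrite inE.
have t0 : 0 < 1 + 2 * L by lra.
have := sum_inv_ge t0 (fun i iA => conj (p1 i iA) (lt_le_trans (p1 i iA) (nbr_weight_ge G p1 iA))).
move=> /le_trans/(_ HS).
have -> : \sum_(i in U) (1 : R) = #|U|%:R by rewrite sumr_const.
(* Out-degrees within [U] are at most [L], and in-degrees have the same total; this is the average
   degree for a Turan-type bound. *)
have : \sum_(i in U) 1 * nbr_weight G (fun=> 1 : R) U i <= #|U|%:R * (1 + 2 * L).
  apply: (@le_trans _ _ (\sum_(j in U) (1 + \sum_(i in U) (G i j)%:R + \sum_(i in U) (G j i)%:R))).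
    apply: ler_sum => j jU; rewrite mul1r /nbr_weight big_mkcondr /=.
    have e1 : \sum_(i in U) (i == j)%:R = 1 :> R.
      by rewrite (bigD1 j) //= eqxx big1 ?addr0 // => i /andP[_ /negPf ->].
    rewrite -[X in _ <= X + _ + _]e1 -!big_split /=; apply: ler_sum => i _.
    by case: (i == j); case: (G i j); case: (G j i) => /=; lra.
  rewrite !big_split /= [X in _ + X + _]exchange_big /= sumr_const.
  have out : \sum_(j in U) \sum_(i in U) (G j i)%:R <= #|U|%:R * L.
    rewrite mulr_natl -sumr_const; apply: ler_sum => j _; apply: le_trans (HU j).
    rewrite -sum1_card natr_sum big_mkcond [leRHS]big_mkcond /=; apply: ler_sum => i _.
    by rewrite !inE; case: (i \in s); case: (G j i).
  lra.
set N := \sum_(i in U) _ => HN HS2.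
have : #|U|%:R <= (1 + 2 * L) * #|S|%:R.
  have -> : #|U|%:R = (1 + 2 * L) * (2 * #|U|%:R / (1 + 2 * L) -
      #|U|%:R * (1 + 2 * L) / (1 + 2 * L) ^+ 2) by field; rewrite gt_eqF.
  rewrite ler_pM2l //; apply: le_trans HS2; rewrite lerD2l lerN2.
  by rewrite ler_pM2r // invr_gt0 exprn_gt0.
move=> /(ler_wpM2l L0); rewrite mulrA; exact: le_trans.
Qed.
End WeakDominationCore.

Lemma exp2_le_ln (R : realType) (x : R) (n : nat) : 0 < x ->
  2 ^+ n <= x * expR 1 -> n%:R <= 2 + 2 * ln x.
Proof.
move=> x0 H; have e2 : expR 2^-1 <= 2 :> R.
  rewrite -[X in expR X]opprK expRN -[leRHS]invrK lef_pV2 ?posrE ?expR_gt0 //.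
  apply: le_trans (expR_ge1Dx _); rewrite le_eqVlt; apply/orP; left; apply/eqP.
  by field.
have : expR 2^-1 ^+ n <= x * expR 1 by rewrite (le_trans _ H) // lerXn2r ?nnegrE ?expR_ge0.
by rewrite -expRM_natl -{1}(lnK x0) -expRD ler_expR; lra.
Qed.

(** * Lower bound for weakly observable graphs *)

Section WeakLower.
Variables (R : realType) (K : nat) (G : rel 'I_K) (T : nat).
Hypotheses (K_ge2 : (2 <= K)%N) (KT : (K ^ 3 <= T)%N).
Hypothesis weak : weakly_observable G.
Let K_gt0 : (0 < K)%N. Proof. exact: ltnW. Qed.
Let Lam : R := ln (K * T)%:R.
Let delta : R := (weak_domination_number G)%:R.
Let Lam_ge1 : 1 <= Lam. Proof. exact: ln_KT_ge1. Qed.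

Let hard_instance (a : 'I_K) (U : {set 'I_K}) (L : R) :=
  [/\ a \notin U, (0 < #|U|)%N, forall i k, i \in a |: U -> k \in U -> ~~ G i k,
    1 <= L & forall i, \sum_(k in U) (G i k)%:R <= L].

(** A weakly observable [w] has no loop and is missed by some [a != w]. This suffices when [delta]
    is polylogarithmic. *)
Lemma hard_singleton : exists a U, hard_instance a U 1 /\ #|U| = 1%N.
Proof.
have [w ww] := exists_weakly_observable weak.
have /andP[_] := ww; rewrite negb_or => /andP[Gww /forallPn[a]].
rewrite negb_imply => /andP[aw Gaw]; exists a, [set w]; rewrite cards1; split => //; split; rewrite ?cards1 ?inE //.
- move=> i k; rewrite !inE => /orP[/eqP->|/eqP->] /eqP-> //.
- by move=> i; rewrite big_set1 lern1 leq_b1.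
Qed.

Lemma hard_large : 4096 * Lam ^+ 6 < delta ->
  exists a U L, hard_instance a U L /\ delta * L <= 4096 * Lam ^+ 6 * #|U|%:R.
Proof.
have aux (x y : R) : 1 <= x -> y <= x -> 2 + 2 * y <= 4 * x by lra.
move=> big; have L1 := Lam_ge1.
have L3 : Lam ^+ 3 <= Lam ^+ 6 by rewrite ler_weXn2l.
have L2 : Lam <= Lam ^+ 3 by rewrite -{1}(expr1 Lam) ler_weXn2l.
have L0 : 0 < Lam by exact: lt_le_trans Lam_ge1.
have lnKL : ln K%:R <= Lam by exact: ln_K_le.
have lnK0 : 0 <= ln K%:R :> R by rewrite ln_ge0 // ler1n.
have [d [d1 deltad small]] : exists d : nat, [/\ 1 <= d%:R :> R,
    delta <= 8 * Lam * d%:R & d%:R * ln K%:R + 1 < delta].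
  (* The largest order of [d] that [hard_core] allows; the slack absorbs the rounding to an
     integer. *)
  pose x := (delta - 1) / (2 * Lam).
  have x1 : 1 <= x by rewrite /x ler_pdivlMr ?mulr_gt0 //; lra.
  pose d := Num.truncn x.
  have /andP[dx xd] := Num.Theory.truncn_itv (le_trans ler01 x1).
  rewrite -/d in dx xd.
  have d1 : 1 <= d%:R :> R by rewrite ler1n Num.Theory.truncn_gt0.
  have xL : x * (2 * Lam) = delta - 1 by rewrite divfK // gt_eqF // mulr_gt0.
  have deltad : delta <= 8 * Lam * d%:R.
    have : x <= 2 * d%:R by rewrite -natr1 in xd; lra.
    move=> /(ler_wpM2r (ltW (mulr_gt0 (ltr0n R 2) L0))); rewrite xL; nra.
  have small : d%:R * ln K%:R + 1 < delta.
    have := ler_wpM2r (ltW L0) dx; have := ler_wpM2l (ler0n R d) lnKL; nra.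
  by exists d.
have [A [AW An0 HA]] := hard_core K_gt0 d1 small.
have d0 : 0 < d%:R :> R by exact: lt_le_trans d1.
have [s [ss sA Hs]] := sample_core d0 An0 HA d.
have K0 : 0 < K%:R :> R by rewrite ltr0n.
have [L [HL Lg2 LL]] : exists L : R, [/\ forall v, (count (G v) s)%:R <= L, 2 <= L & L <= 4 * Lam].
  (* With [d] sampled points the exponential sum is at most [K * (1 + d^-1) ^+ d <= K * expR 1], so
     each single count is logarithmic. *)
  pose L : R := 2 + 2 * ln K%:R.
  have HL v : (count (G v) s)%:R <= L.
    apply: exp2_le_ln => //; apply: (@le_trans _ _ (\sum_v 2 ^+ count (G v) s)).
      by rewrite (bigD1 v) //= lerDl; apply: sumr_ge0 => u _; rewrite exprn_ge0.
    apply: (le_trans Hs); rewrite ler_pM2l //.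
    apply: (@le_trans _ _ (expR d%:R^-1 ^+ d)).
      by rewrite lerXn2r ?nnegrE ?expR_ge0 ?expR_ge1Dx // addr_ge0 ?invr_ge0.
    by rewrite -expRM_natl mulfV ?gt_eqF.
  exists L; split=> //; first by rewrite /L lerDl mulr_ge0.
  exact: aux.
have sW : {subset s <= [set w | weakly_observable_vertex G w]}.
  by move=> w /sA; exact: (subsetP AW).
have [S [Ss indS HS]] := sparse_independent (le_trans (ler0n R 2) Lg2) sW HL.
rewrite ss in HS.
have dS : d%:R <= 48 * Lam ^+ 2 * #|S|%:R.
  apply: (le_trans HS); rewrite ler_wpM2r //.
  have : L ^+ 2 <= (4 * Lam) ^+ 2 by rewrite lerXn2r ?nnegrE //; lra.
  by rewrite exprMn expr2; nra.
have S2 : (1 < #|S|)%N.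
  rewrite ltnNge; apply/negP => S1; have : #|S|%:R <= 1 :> R by rewrite lern1.
  move=> S1'; have : d%:R <= 48 * Lam ^+ 2.
    by apply: (le_trans dS); rewrite ler_piMr // mulr_ge0 // sqr_ge0.
  move=> /(ler_wpM2l (mulr_ge0 (ler0n R 8) (ltW L0))) H.
  have : delta <= 384 * Lam ^+ 3.
    by apply: (le_trans deltad); apply: (le_trans H); rewrite le_eqVlt; apply/orP; left; apply/eqP; ring.
  by have := exprn_ge0 3 (ltW L0); lra.
have /card_gt0P[a aS] : (0 < #|S|)%N by exact: ltnW.
have cS := cardsD1 a S; rewrite aS add1n in cS.
exists a, (S :\ a), L; split; last first.
  set n : R := #|S :\ a|%:R; have n1 : 1 <= n by rewrite ler1n -ltnS -cS.
  have Sn : #|S|%:R <= 2 * n by rewrite cS -natr1 -/n; lra.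
  have dn : d%:R <= 96 * Lam ^+ 2 * n.
    apply: (le_trans dS); rewrite (_ : 96 * Lam ^+ 2 * n = 48 * Lam ^+ 2 * (2 * n)); last by ring.
    by rewrite ler_wpM2l // mulr_ge0 // sqr_ge0.
  have d0' : 0 <= delta by exact: ler0n.
  apply: (@le_trans _ _ (8 * Lam * d%:R * (4 * Lam))).
    by apply: ler_pM => //; exact: le_trans Lg2.
  have l2 : 0 <= 32 * Lam ^+ 2 by rewrite mulr_ge0 // sqr_ge0.
  have := ler_wpM2l l2 dn.
  have L4 : Lam ^+ 4 <= Lam ^+ 6 by rewrite ler_weXn2l.
  have : 3072 * (Lam ^+ 4 * n) <= 4096 * (Lam ^+ 6 * n).
    have l4 : 0 <= Lam ^+ 4 * n by rewrite mulr_ge0 ?exprn_ge0 ?(ltW L0) // (le_trans ler01).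
    have := ler_wpM2r (le_trans ler01 n1) L4; lra.
  rewrite (_ : 32 * Lam ^+ 2 * (96 * Lam ^+ 2 * n) = 3072 * (Lam ^+ 4 * n)); last by ring.
  rewrite (_ : 8 * Lam * d%:R * (4 * Lam) = 32 * Lam ^+ 2 * d%:R); last by ring.
  by move=> H2 H1; rewrite -[leRHS]mulrA; exact: le_trans H2.
split.
- by rewrite setD11.
- by rewrite -ltnS -cS.
- rewrite setD1K // => i k iS; rewrite !inE => /andP[_ kS].
  have [->|ik] := eqVneq i k; first by apply: weak_no_loop; apply: sW; exact: Ss.
  by move/forall_inP : indS => /(_ _ iS)/forall_inP/(_ _ kS)/implyP; apply.
- lra.
- move=> i; apply: le_trans (HL i); rewrite -natr_sum ler_nat.
  apply: (@leq_trans #|[set w in s | G i w]|); last exact: card_filter_le.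
  rewrite -sum1_card big_mkcond [leqRHS]big_mkcond; apply: leq_sum => k _.
  rewrite !inE; case: ifP => // /andP[_ /Ss ->].
  by case: (G i k).
Qed.

Lemma weak_lower :
  512^-1 * (powR delta (1 / 3) * powR T%:R (2 / 3)) / Lam ^+ 2 <= minimax_regret R G T.
Proof.
have delta1 : 1 <= delta by rewrite ler1n weak_domination_number_gt0.
have L0 : 0 < Lam by exact: lt_le_trans Lam_ge1.
have [a [U [L [[aU U0 nedge L1 HL] HdL]]]] :
    exists a U L, hard_instance a U L /\ delta * L <= 4096 * Lam ^+ 6 * #|U|%:R.
  have [small|] := leP delta (4096 * Lam ^+ 6); last exact: hard_large.
  have [a [U [H cU]]] := hard_singleton.
  by exists a, U, 1; rewrite cU !mulr1.
apply: le_trans (dominated_lower K_ge2 KT aU U0 nedge L1 HL).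
have n0 : 0 < #|U|%:R :> R by rewrite ltr0n.
have L0' : 0 < L by exact: lt_le_trans L1.
have nL0 : 0 < #|U|%:R / L by rewrite divr_gt0.
set z := powR (#|U|%:R / L) (1 / 3); set s := powR delta (1 / 3).
have z3 : z ^+ 3 = #|U|%:R / L by exact: cuberootK.
have s3 : s ^+ 3 = delta by apply: cuberootK; exact: lt_le_trans delta1.
have z0 : 0 <= z by exact: powR_ge0.
have s0 : 0 <= s by exact: powR_ge0.
(* Cube root of [delta <= 4096 * Lam ^+ 6 * (#|U| / L)]; the factor [16], with the [32] of
   [dominated_lower], gives [512]. *)
have sz : s <= 16 * Lam ^+ 2 * z.
  rewrite -(ler_pXn2r (n := 3)) ?nnegrE // ?mulr_ge0 ?exprn_ge0 ?(ltW L0) //.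
  rewrite exprMn z3 s3 mulrA ler_pdivlMr //; apply: (le_trans HdL).
  by rewrite le_eqVlt; apply/orP; left; apply/eqP; ring.
set y := powR T%:R (2 / 3); have y0 : 0 <= y by exact: powR_ge0.
rewrite ler_pdivrMr ?exprn_gt0 //.
rewrite (_ : z * y / 32 * Lam ^+ 2 = 512^-1 * (16 * Lam ^+ 2 * z * y)); last by field.
apply: ler_wpM2l; first by rewrite invr_ge0 ler0n.
exact: (ler_wpM2r y0 sz).
Qed.
End WeakLower.


Theorem theorem1 (R : realType) :
  (exists (c C : R) (m : nat), 0 < c /\ 0 < C /\
    forall (K : nat) (G : rel 'I_K) (T : nat),
      (2 <= K)%N -> (K ^ 3 <= T)%N -> strongly_observable G ->
      c * Num.sqrt ((independence_number G)%:R * T%:R) / (ln ((K * T)%:R)) ^+ m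
        <= minimax_regret R G T
      /\ minimax_regret R G T
        <= C * Num.sqrt ((independence_number G)%:R * T%:R) * (ln ((K * T)%:R)) ^+ m)
  /\
  (exists (c C : R) (m : nat), 0 < c /\ 0 < C /\
    forall (K : nat) (G : rel 'I_K) (T : nat),
      (2 <= K)%N -> (K ^ 3 <= T)%N -> weakly_observable G ->
      c * (powR (weak_domination_number G)%:R (1 / 3) * powR T%:R (2 / 3))
          / (ln ((K * T)%:R)) ^+ m
        <= minimax_regret R G T
      /\ minimax_regret R G T
        <= C * (powR (weak_domination_number G)%:R (1 / 3) * powR T%:R (2 / 3))
            * (ln ((K * T)%:R)) ^+ m)
  /\
  (exists (c C : R), 0 < c /\ 0 < C /\
    forall (K : nat) (G : rel 'I_K) (T : nat),
      (2 <= K)%N -> (K ^ 3 <= T)%N -> ~~ observable G ->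
      c * T%:R <= minimax_regret R G T /\ minimax_regret R G T <= C * T%:R).
Proof.
split; [|split].
- exists 96^-1, 16, 1%N; split; [by rewrite invr_gt0 ltr0n|split; [by rewrite ltr0n|]].
  move=> K G T K2 KT strong.
  have L1 : 1 <= ln (K * T)%:R :> R by exact: ln_KT_ge1.
  rewrite expr1; split; last exact: strong_upper.
  apply: le_trans (strong_lower R G K2 KT).
  have L0 := lt_le_trans ltr01 L1.
  by rewrite [X in X / _]mulrC ler_pdivrMr // ler_peMr // divr_ge0 ?sqrtr_ge0.
(* The exponent [2] comes from the lower bound; the upper bound, with one logarithm, is weakened
   using [Lam >= 1]. *)
- exists 512^-1, 12, 2%N; split; [by rewrite invr_gt0 ltr0n|split; [by rewrite ltr0n|]].
  move=> K G T K2 KT weak.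
  have L1 : 1 <= ln (K * T)%:R :> R by exact: ln_KT_ge1.
  split; first exact: weak_lower.
  apply: (le_trans (weak_upper R K2 KT weak)).
  rewrite ler_wpM2l ?mulr_ge0 ?powR_ge0 // expr2 ler_peMr // (le_trans ler01) //.
- exists 4^-1, 1; split; [by rewrite invr_gt0 ltr0n|split; [exact: ltr01|]].
  move=> K G T K2 KT unobs.
  split; last by rewrite mul1r; exact: minimax_regret_leT.
  by rewrite mulrC; exact: unobservable_lower.
Qed.
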